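(* Let $l>0$, $m\ge 1$, $A_0>0$, $A_1,\dots,A_{2m}\in\mathbb{R}$, $\sigma>0$, put $\mathbb{A}=\sum_{n=0}^{2m}A_n\frac{\partial^n}{\partial x^n}$, and let $(W(t,\omega))_{t\ge 0}$ be a Wiener process on a probability space $(\Omega,\mathcal{F},P)$. Consider the $\mathbb{C}[-l,l[$-valued stochastic process $(\xi(t,\cdot,\omega))_{t\ge 0}$ defined by $$\xi(t,\cdot,\omega)=e^{t\mathbb{A}}\theta+\sigma\int_0^t e^{(t-\tau)\mathbb{A}}I_{[-l,l[}\,dW(\tau,\omega),$$ where $\theta\in FD^{(0)}[-l,l[$. Assume that the regularity condition (R) stated in the context is satisfied. For a fixed $t_0>0$, denote by $\mu_\theta$ the probability measure on $\mathbb{C}[-l,l[$ defined by the random element $\omega\mapsto\xi(t_0,\cdot,\omega)$. For each $(Z_k)_{k\in\mathbb{N}}\in(\mathbb{C}[-l,l[)^{\mathbb{N}}$ put $$T_n((Z_k)_{k\in\mathbb{N}})=e^{-t_0\mathbb{A}}\Big(\frac{1}{n}\sum_{k=1}^n Z_k\Big),\qquad n\in\mathbb{N}.$$ Then $T_n$ is a consistent estimate of the useful signal $\theta$, in the sense that $$\mu_\theta^{\mathbb{N}}\Big(\Big\{(Z_k)_{k\in\mathbb{N}}:\ \lim_{n\to\infty}\|T_n((Z_k)_{k\in\mathbb{N}})-\theta\|=0\Big\}\Big)=1$$ for each $\theta\in FD^{(0)}[-l,l[$.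
   Context: $[-l,l[$ is the half-open interval $\{x:-l\le x<l\}$ and $I_{[-l,l[}$ is its indicator function (the constant function $1$ on $[-l,l[$). $\mathbb{C}[-l,l[$ is the Banach space of all real-valued bounded continuous functions on $[-l,l[$ with the supremum norm $\|\cdot\|$. $FD^{(0)}[-l,l[\subset\mathbb{C}[-l,l[$ is the vector space of those functions whose Fourier series (with respect to $\cos(k\pi x/l),\sin(k\pi x/l)$) converges to the function at every point of $[-l,l[$. $FD^{(2m)}[-l,l[$ is the class of $2m$ times differentiable functions $f$ on $[-l,l[$ with $f\in FD^{(0)}[-l,l[$ such that for each $0\le j\le 2m-1$ the series obtained by differentiating the Fourier series of $f^{(j)}$ term by term converges to $f^{(j+1)}$ at every point of $[-l,l[$. For $k\ge1$ put $\sigma_k=\sum_{n=0}^{m}(-1)^nA_{2n}\left(\frac{k\pi}{l}\right)^{2n}$ and $\omega_k=\sum_{n=0}^{m-1}(-1)^nA_{2n+1}\left(\frac{k\pi}{l}\right)^{2n+1}$. (The numbers $\sigma_k$ are distinct from the constant $\sigma$, and the numbers $\omega_k$ from the sample point $\omega$.) For $s\in\mathbb{R}$ and $f(x)=\frac{c_0}{2}+\sum_{k=1}^\infty \left(c_k\cos\frac{k\pi x}{l}+d_k\sin\frac{k\pi x}{l}\right)\in FD^{(0)}[-l,l[$, the function $e^{s\mathbb{A}}f$ is $$(e^{s\mathbb{A}}f)(x)=\frac{e^{sA_0}c_0}{2}+\sum_{k=1}^\infty e^{\sigma_k s}\Big((c_k\cos(\omega_k s)+d_k\sin(\omega_k s))\cos\tfrac{k\pi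 x}{l}+(d_k\cos(\omega_k s)-c_k\sin(\omega_k s))\sin\tfrac{k\pi x}{l}\Big),$$ defined whenever this series converges at every $x\in[-l,l[$. In particular $e^{s\mathbb{A}}I_{[-l,l[}=e^{sA_0}I_{[-l,l[}$. The estimator $T_n$ is understood on those sequences for which $e^{-t_0\mathbb{A}}$ is defined at $\frac1n\sum_{k=1}^n Z_k$. Regularity condition (R): writing $\theta(x)=\frac{c_0}{2}+\sum_{k\ge1}\left(c_k\cos\frac{k\pi x}{l}+d_k\sin\frac{k\pi x}{l}\right)$, the sequence $(\frac{c_0}{2},c_1,d_1,c_2,d_2,\dots)$ of real numbers is such that the series $$\frac{e^{tA_0}c_0}{2}+\sum_{k=1}^\infty e^{\sigma_k t}\Big((c_k\cos(\omega_k t)+d_k\sin(\omega_k t))\cos\tfrac{k\pi x}{l}+(d_k\cos(\omega_k t)-c_k\sin(\omega_k t))\sin\tfrac{k\pi x}{l}\Big)+\sigma\int_0^te^{(t-\tau)A_0}dW(\tau,\omega)\,I_{[-l,l[}(x)$$ belongs to the class $FD^{(2m)}[-l,l[$ as a series in the variable $x$ for all $t\ge0$, $\omega\in\Omega$, and is differentiable term by term as a series in the variable $t$ for all $x\in[-l,l[$, $\omega\in\Omega$. $\mu_\theta^{\mathbb{N}}$ denotes the countable product of copies of $\mu_\theta$ on $(\mathbb{C}[-l,l[)^{\mathbb{N}}$. *)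

(* Defs.v *)
From HB Require Import structures.
From mathcomp Require Import all_boot all_order all_algebra.
From mathcomp Require Import all_classical all_reals all_analysis.

Set Implicit Arguments.
Unset Strict Implicit.
Unset Printing Implicit Defensive.

Import Order.TTheory GRing.Theory Num.Theory.
Import numFieldNormedType.Exports.

Local Open Scope classical_set_scope.
Local Open Scope ring_scope.

Definition itvl {R : realType} (l : R) : set R := `[- l, l[%classic.

(* A function on [-l, l[ is represented by its extension by 0 to R, so that
   equality of functions on [-l, l[ is Leibniz equality. *)
Definition bcont {R : realType} (l : R) : {pred R -> R} :=
  mem [set f : R -> R | [/\ {within itvl l, continuous f},
    exists M, forall x, itvl l x -> `|f x| <= M &
    forall x, ~ itvl l x -> f x = 0]].

Record bcfun (R : realType) (l : R) := BCFun {
  bcfun_fun :> R -> R;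
  bcfun_prop : bcfun_fun \in bcont l }.

Section bcfun_lmodule.
Context {R : realType} (l : R).

Lemma bcont_submod_closed : submod_closed (bcont l : {pred R -> R}).
Proof.
split.
  rewrite inE; split; [|by exists 0 => x _; rewrite normr0|by []].
  by move=> x; exact: cst_continuous.
move=> a f g /set_mem[fc [Mf fM] f0] /set_mem[gc [Mg gM] g0].
apply/mem_set; split.
- move=> x; apply: (@continuousD R R^o (subspace (itvl l))); last exact: gc.
  apply: (@continuousZl_tmp R R^o (subspace (itvl l))); exact: fc.
- exists (`|a| * Mf + Mg) => x lx.
  rewrite (le_trans (ler_normD _ _))// lerD ?gM//.
  by rewrite normrM ler_wpM2l ?fM.
- move=> x lx; rewrite [LHS](_ : _ = a * f x + g x)//.
  by rewrite f0// g0// mulr0 addr0.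
Qed.

HB.instance Definition _ := GRing.isSubmodClosed.Build R (R -> R) (bcont l)
  bcont_submod_closed.

HB.instance Definition _ := [isSub for @bcfun_fun R l].
HB.instance Definition _ := [Choice of bcfun l by <:].
HB.instance Definition _ := [SubChoice_isSubLmodule of bcfun l by <:].

Definition supnorm (f : bcfun l) : R := sup [set `|f x| | x in itvl l].

Lemma bcfun_bounded (f : bcfun l) : has_ubound [set `|f x| | x in itvl l].
Proof.
have /set_mem[_ [M fM] _] := bcfun_prop f.
by exists M => _ [x lx <-]; exact: fM.
Qed.

Lemma bcfun_out (f : bcfun l) x : ~ itvl l x -> f x = 0.
Proof. by have /set_mem[_ _] := bcfun_prop f; exact. Qed.

Lemma supnorm_ub (f : bcfun l) x : itvl l x -> `|f x| <= supnorm f.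
Proof. by move=> lx; apply: ub_le_sup; [exact: bcfun_bounded|exists x]. Qed.

Lemma supnorm_le (f : bcfun l) M :
  0 <= M -> (forall x, itvl l x -> `|f x| <= M) -> supnorm f <= M.
Proof.
move=> M0 fM; rewrite /supnorm.
have [->|/set0P E0] := eqVneq [set `|f x| | x in itvl l] set0.
  by rewrite sup0.
by apply: ge_sup => // _ [x lx <-]; exact: fM.
Qed.

Lemma supnorm_ge0 (f : bcfun l) : 0 <= supnorm f.
Proof.
have [lx|lx] := pselect (exists x, itvl l x).
  by have [x /(supnorm_ub f)] := lx; exact: le_trans.
rewrite /supnorm (_ : [set _ | _ in _] = set0) ?sup0//.
by rewrite -subset0 => y [x xl _]; apply: lx; exists x.
Qed.

Lemma supnormD (f g : bcfun l) : supnorm (f + g) <= supnorm f + supnorm g.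
Proof.
apply: supnorm_le => [|x lx]; first by rewrite addr_ge0 ?supnorm_ge0.
rewrite (le_trans (ler_normD _ _))// lerD//; exact: supnorm_ub.
Qed.

Let supnormZ_le a (f : bcfun l) : supnorm (a *: f) <= `|a| * supnorm f.
Proof.
apply: supnorm_le => [|x lx]; first by rewrite mulr_ge0 ?supnorm_ge0.
by rewrite normrM ler_wpM2l ?supnorm_ub.
Qed.

Lemma supnormZ a (f : bcfun l) : supnorm (a *: f) = `|a| * supnorm f.
Proof.
apply/eqP; rewrite eq_le supnormZ_le/=.
have [->|a0] := eqVneq a 0; first by rewrite normr0 mul0r supnorm_ge0.
have := supnormZ_le a^-1 (a *: f).
by rewrite scalerA mulVf// scale1r normfV ler_pdivlMl ?normr_gt0.
Qed.

Lemma supnorm0_eq0 (f : bcfun l) : supnorm f = 0 -> f = 0.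
Proof.
move=> f0; apply: val_inj; apply/funext => x /=.
have [lx|lx] := pselect (itvl l x); last by rewrite bcfun_out.
by apply/eqP; rewrite -normr_le0 -f0 supnorm_ub.
Qed.

HB.instance Definition _ := Lmodule_isNormed.Build R (bcfun l)
  supnormD supnormZ supnorm0_eq0.

Lemma indic_itvl_bcont : \1_(itvl l) \in bcont l.
Proof.
apply/mem_set; split.
- have /subspace_eq_continuous : {in itvl l, cst 1 =1 (\1_(itvl l) : R -> R)}.
    by move=> x lx; rewrite indicE lx.
  by apply => x; exact: cst_continuous.
- exists 1 => x _; rewrite indicE; case: (x \in _) => /=; rewrite ?normr1 ?normr0//.
- by move=> x lx; rewrite indicE memNset.
Qed.

Definition indic_itvl : bcfun l := BCFun indic_itvl_bcont.

End bcfun_lmodule.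

Section fourier.
Context {R : realType} (l : R).

Definition fourier_cos (f : R -> R) (k : nat) : R :=
  l^-1 * \int[lebesgue_measure]_(x in itvl l) (f x * cos (k%:R * pi * x / l)).

Definition fourier_sin (f : R -> R) (k : nat) : R :=
  l^-1 * \int[lebesgue_measure]_(x in itvl l) (f x * sin (k%:R * pi * x / l)).

Definition fourier_term (f : R -> R) (k : nat) (x : R) : R :=
  if k is 0 then fourier_cos f 0%N / 2
  else fourier_cos f k * cos (k%:R * pi * x / l) +
       fourier_sin f k * sin (k%:R * pi * x / l).

Definition FD0 (f : bcfun l) : Prop :=
  forall x, itvl l x -> series (fun k => fourier_term f k x) @ \oo --> f x.

(* One-sided at the endpoints of D that belong to D. *)
Definition has_derivative_within (D : set R) (f : R -> R) (a v : R) : Prop :=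
  (fun y => (f y - f a) / (y - a)) @ within D a^' --> v.

(* g j is the j-th derivative of f on [-l, l[; its values elsewhere are
   irrelevant.  Integrability is what the Fourier series of f^(j) needs in
   order to be defined. *)
Definition FD (N : nat) (f : bcfun l) : Prop :=
  FD0 f /\ exists g : nat -> R -> R, g 0%N = f /\
    forall j, (j < N)%N ->
      lebesgue_measure.-integrable (itvl l) (EFin \o g j) /\
      forall x, itvl l x ->
        has_derivative_within (itvl l) (g j) x (g j.+1 x) /\
        series (fun k => derive1 (fourier_term (g j) k) x) @ \oo --> g j.+1 x.

Definition termwise_differentiable (D : set R) (u : nat -> R -> R) : Prop :=
  exists U V : R -> R, forall t, D t ->
    [/\ series (fun k => u k t) @ \oo --> U t,
        series (fun k => derive1 (u k) t) @ \oo --> V t &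
        has_derivative_within D U t (V t)].

End fourier.

(* A = (A_0, ..., A_(2m)); the values A n for n > 2m are never used. *)
Section exponential.
Context {R : realType} (l : R) (m : nat) (A : nat -> R).

Definition sigma_ (k : nat) : R :=
  \sum_(n < m.+1) (-1) ^+ n * A n.*2 * (k%:R * pi / l) ^+ n.*2.

Definition omega_ (k : nat) : R :=
  \sum_(n < m) (-1) ^+ n * A n.*2.+1 * (k%:R * pi / l) ^+ n.*2.+1.

Definition expA_term (s : R) (f : R -> R) (k : nat) (x : R) : R :=
  let c := fourier_cos l f in let d := fourier_sin l f in
  if k is 0 then expR (s * A 0%N) * c 0%N / 2
  else expR (sigma_ k * s) *
    ((c k * cos (omega_ k * s) + d k * sin (omega_ k * s)) *
       cos (k%:R * pi * x / l) +
     (d k * cos (omega_ k * s) - c k * sin (omega_ k * s)) *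
       sin (k%:R * pi * x / l)).

Definition is_expA (s : R) (f g : bcfun l) : Prop :=
  FD0 f /\
  forall x, itvl l x -> series (fun k => expA_term s f k x) @ \oo --> g x.

Definition expA_defined (s : R) (f : bcfun l) : Prop := exists g, is_expA s f g.

(* Equal to 0 when not (expA_defined s f). *)
Definition expA (s : R) (f : bcfun l) : bcfun l := xget 0 [set g | is_expA s f g].

End exponential.

Section wiener.
Context {R : realType} {d : measure_display} {Omega : measurableType d}.
Variable P : probability Omega R.

(* Only the values W t with t >= 0 matter. *)
Record wiener_process (W : R -> Omega -> R) : Prop := {
  wiener_measurable : forall t : R, 0 <= t -> measurable_fun setT (W t);
  wiener_start : {ae P, forall w, W 0 w = 0};
  wiener_continuous :
    {ae P, forall w, {within `[0, +oo[%classic, continuous (fun t => W t w)}};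
  wiener_normal : forall s t : R, 0 <= s -> s < t ->
    forall B : set R, measurable B ->
      P [set w | B (W t w - W s w)] = normal_prob 0 (Num.sqrt (t - s)) B;
  wiener_independent : forall (n : nat) (t : nat -> R), 0 <= t 0%N ->
    (forall i, (i < n)%N -> t i <= t i.+1) ->
    forall B : nat -> set R, (forall i, measurable (B i)) ->
      P [set w | forall i, (i < n)%N -> B i (W (t i.+1) w - W (t i) w)] =
      (\prod_(i < n) P [set w | B i (W (t i.+1) w - W (t i) w)%R])%E }.

Variable V : normedModType R.

(* The step function equal to sf_val i on [sf_pt i, sf_pt (i+1)[,
   i < sf_size. *)
Record stepfun := StepFun {
  sf_size : nat;
  sf_pt : nat -> R;
  sf_val : nat -> V }.

Definition partitions (t : R) (h : stepfun) : Prop :=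
  [/\ sf_pt h 0%N = 0, sf_pt h (sf_size h) = t &
      forall i, (i < sf_size h)%N -> sf_pt h i <= sf_pt h i.+1].

Definition stepfun_eval (h : stepfun) (x : R) : V :=
  \sum_(i < sf_size h) \1_(`[sf_pt h i, sf_pt h i.+1[%classic) x *: sf_val h i.

Definition step_integral (W : R -> Omega -> R) (h : stepfun) (w : Omega) : V :=
  \sum_(i < sf_size h) (W (sf_pt h i.+1) w - W (sf_pt h i) w) *: sf_val h i.

(* J is (a version of) int_0^t g dW for the nonrandom integrand g: the mean
   square limit of the integrals of step functions tending to g in L^2. *)
Definition wiener_integral (W : R -> Omega -> R) (t : R) (g : R -> V)
    (J : Omega -> V) : Prop :=
  (forall U : set V, open U -> measurable (J @^-1` U)) /\
  exists h : nat -> stepfun,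
    [/\ forall n, partitions t (h n),
        (\int[lebesgue_measure]_(x in `[0%R, t])
           ((`|stepfun_eval (h n) x - g x| ^+ 2)%:E))%E @[n --> \oo] --> 0%E &
        (\int[P]_w ((`|step_integral W (h n) w - J w| ^+ 2)%:E))%E
           @[n --> \oo] --> 0%E].

End wiener.

(* The regularity condition on theta.  N t w stands for
   int_0^t e^((t - tau) A_0) dW(tau, w).  It is a single term of the series,
   whose derivative in t exists only as a stochastic differential; termwise
   differentiability in t therefore bears on the remaining terms. *)
Definition regular {R : realType} (l : R) (m : nat) (A : nat -> R) (sigma : R)
    (Omega : Type) (theta : bcfun l) (N : R -> Omega -> R) : Prop :=
  (forall (t : R) (w : Omega), 0 <= t -> exists2 g : bcfun l, FD m.*2 g &
     forall x, itvl l x ->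
       series (fun k => expA_term l m A t theta k x) n
         + sigma * N t w * indic_itvl l x @[n --> \oo] --> g x) /\
  (forall x, itvl l x ->
     termwise_differentiable `[0, +oo[%classic
       (fun k t => expA_term l m A t theta k x)).

Definition borel (T : ptopologicalType) := g_sigma_algebraType (@open T).
HB.instance Definition _ (T : ptopologicalType) := Measurable.on (borel T).

Definition cylinders {d : measure_display} (T : measurableType d) :
    set (set (nat -> T)) :=
  [set C | exists k (B : set T), measurable B /\ C = [set Z | B (Z k)]].

Definition seq_space {d : measure_display} (T : measurableType d) :=
  g_sigma_algebraType (@cylinders d T).
HB.instance Definition _ d (T : measurableType d) := Measurable.on (seq_space T).

(* M is the product of countably many copies of mu. *)
Definition countable_product {R : realType} {d : measure_display}
    {T : measurableType d} (mu : set T -> \bar R)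
    (M : probability (seq_space T) R) : Prop :=
  forall (n : nat) (B : nat -> set T), (forall k, measurable (B k)) ->
    M [set Z | forall k, (k < n)%N -> B k (Z k)] = (\prod_(k < n) mu (B k))%E.

(* S, possibly nonmeasurable, has measure 1 for the completion of M. *)
Definition completed_measure_eq1 {R : realType} {d : measure_display}
    {T : measurableType d} (M : probability T R) (S : set T) : Prop :=
  exists B : set T, [/\ measurable B, B `<=` S & M B = 1%E].

(* The sequence Z_1, Z_2, ... is indexed from 0. *)
Definition estimator {R : realType} (l : R) (m : nat) (A : nat -> R) (t0 : R)
    (n : nat) (Z : nat -> bcfun l) : bcfun l :=
  expA m A (- t0) (n%:R^-1 *: \sum_(k < n) Z k).

Definition estimator_defined {R : realType} (l : R) (m : nat) (A : nat -> R)
    (t0 : R) (n : nat) (Z : nat -> bcfun l) : Prop :=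
  expA_defined m A (- t0) (n%:R^-1 *: \sum_(k < n) Z k).

(* Main.v *)
Require Import Defs.
From HB Require Import structures.
From mathcomp Require Import all_boot all_order all_algebra.
From mathcomp Require Import all_classical all_reals all_analysis.
From mathcomp Require Import measurable_realfun ring lra zify.

Set Implicit Arguments.
Unset Strict Implicit.
Unset Printing Implicit Defensive.

Import Order.TTheory GRing.Theory Num.Theory.
Import numFieldNormedType.Exports.

Local Open Scope classical_set_scope.
Local Open Scope ring_scope.

(** At time t0 the observation is a fixed function plus a random multiple of the
constant function 1. Indeed e^((t - tau)A) 1 = e^((t - tau)A_0) 1, so the
integrand of the stochastic integral takes its values on the line spanned by 1,
and almost surely so does the integral: J = G 1 for a centred square integrable
real variable G ([constant_integrand_ae], [constant_integrand_moments]). With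
h = e^(t0 A) theta, the mean of n observations is therefore h + c_n 1, where
c_n is the mean of n independent copies of sigma G, and c_n tends to 0 almost
surely ([orthogonal_law_of_large_numbers]). Applying e^(- t0 A) yields
theta + e^(- t0 A_0) c_n 1 ([is_expA_inverse_affine]), at distance at most
e^(- t0 A_0) |c_n| from theta.

That e^(- t0 A) undoes e^(t0 A) is the analytic core. The inverse operator
reads off the Fourier coefficients of h, which are integrals, whereas h is given
as the pointwise sum of a trigonometric series. By the regularity condition h,
up to a constant, is also the pointwise sum of its own Fourier series, and two
trigonometric series with the same sum everywhere have the same coefficients
([cantor_uniqueness]). The latter follows Riemann. The coefficients are bounded
([cantor_lebesgue_bounded]), so dividing the k-th term by k^2 gives the series
of a continuous function P. Up to a constant factor, the second symmetric difference
quotients of P are means of the original series with weights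
(sin(kd)/(kd))^2; these weights have bounded variation uniformly in d ([riemann_kernel_variation]), hence sum the
series to its limit ([regular_summation]). So P has a constant generalized
second derivative and is a parabola ([schwarz_zero]); being periodic it is
constant, and orthogonality of the trigonometric system gives the rest.

The probabilistic part works with second moments. The variance of the
increments of W is proportional to time, which makes disjoint increments
orthogonal ([wiener_increment_orthogonal]) and yields the isometry
[ito_isometry_step]. Bounded continuous functions on [-l, l[ form a nonseparable
space, in which the norm of a difference of random elements need not be
measurable; the integral of a nonnegative function is nevertheless monotone
([le_lower_integral]), so that mean square convergence in norm passes to
evaluations at points, where everything is measurable. *)

(** * Abel summation and regular means of series *)

Section Summation.
Context {R : realType}.
Implicit Types u v : nat -> R.

(** A majorant in the form of a difference sums explicitly, which gives a rate of
convergence: applied to functions of x, it is a uniform one. *)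
Lemma series_telescoping_majorant v (B : nat -> R) :
  (forall k, `|v k| <= B k - B k.+1) -> B @ \oo --> (0 : R) ->
  cvgn (series v) /\ forall n, `|limn (series v) - series v n| <= B n.
Proof.
move=> vB B0.
have tele m n : (m <= n)%N -> `|series v n - series v m| <= B m - B n.
  move=> mn; rewrite sub_series_geq// (le_trans (ler_norm_sum _ _ _))//.
  rewrite (le_trans (ler_sum _ (fun k _ => vB k)))//.
  rewrite -[leRHS]opprB -telescope_sumr// -sumrN.
  by rewrite le_eqVlt (eq_bigr _ (fun i _ => opprB _ _)) eqxx.
have Bge0 n : 0 <= B n.
  have Bn k : B k.+1 <= B k by rewrite -subr_ge0 (le_trans _ (vB k)).
  have -> : 0 = limn B by apply/esym/cvg_lim.
  apply: nonincreasing_cvgn_ge; last by apply/cvg_ex; exists 0.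
  exact/nonincreasing_seqP.
have cv : cvgn (series v).
  apply/cauchy_cvgP/cauchy_seriesP => e e0.
  have /cvgrPdist_lt/(_ e e0)[N _ BN] := B0.
  exists ([set m | N <= m]%N, [set n | N <= n]%N).
    by split; exists N.
  move=> [m n] /= [Nm Nn].
  have [nm|mn] := leqP n m; first by rewrite big_geq// normr0.
  rewrite -sub_series_geq ?(ltnW mn)// (le_lt_trans (tele _ _ (ltnW mn)))//.
  rewrite (@le_lt_trans _ _ (B m))// ?gerBl//.
  by have := BN _ Nm; rewrite sub0r normrN ger0_norm.
split => // n.
have h : `|series v k - series v n| @[k --> \oo] -->
    `|limn (series v) - series v n|.
  by apply: cvg_norm; apply: cvgB => //; exact: cvg_cst.
rewrite -(cvg_lim _ h)//; apply: limr_le; first by apply/cvg_ex; eexists; exact: h.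
near=> k; rewrite (le_trans (tele n k _))//; last by rewrite gerBl.
by near: k; exists n.
Unshelve. all: by end_near. Qed.

Lemma abel_summation u v n :
  series (u \* v) n.+1 =
  \sum_(0 <= k < n) series u k.+1 * (v k - v k.+1) + series u n.+1 * v n.
Proof.
rewrite /series /=; elim: n => [|n IH].
  by rewrite big_nat1 big_geq// add0r big_nat1.
rewrite big_nat_recr//= IH [in RHS]big_nat_recr//=.
rewrite [\sum_(0 <= k < n.+2) u k]big_nat_recr//=.
ring.
Qed.

(** Summation by parts turns the phi-means into means of the partial sums with
weights phi j k - phi j k.+1. Uniformly bounded variation controls the tail of
these means, and each single weight tends to 0. *)
Lemma regular_summation u (phi : nat -> nat -> R) (V : R) (L : nat -> R) :
  series u @ \oo --> (0 : R) ->
  (forall k, phi j k @[j --> \oo] --> (1 : R)) ->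
  (forall j k, `|phi j k| <= 1) ->
  (forall j n, \sum_(0 <= k < n) `|phi j k - phi j k.+1| <= V) ->
  (forall j, series (u \* phi j) @ \oo --> L j) ->
  L @ \oo --> (0 : R).
Proof.
move=> u0 phi1 phib phiV uL.
have V0 : 0 <= V by rewrite (le_trans _ (phiV 0 0))// big_geq.
apply/cvgrPdist_le => e e0; pose d := e / (V + 1 + 1).
have d0 : 0 < d by rewrite divr_gt0// addr_gt0// ltr_wpDl.
have /cvgrPdist_le/(_ _ d0)[N _ uN] := u0.
pose A j := \sum_(0 <= k < N) `|series u k.+1| * `|phi j k - phi j k.+1|.
have A0 : A @ \oo --> (0 : R).
  rewrite [X in _ --> X](_ : 0 = \sum_(0 <= k < N) `|series u k.+1| * `|1 - 1|).
    apply: cvg_big => [|k _]; first exact: add_continuous.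
    by apply: cvgMr; apply: cvg_norm; apply: cvgB; exact: phi1.
  by rewrite big1// => k _; rewrite subrr normr0 mulr0.
have /cvgrPdist_le/(_ _ d0) Ad := A0.
near=> j; rewrite sub0r normrN.
have -> : e = d * (V + 1 + 1) by rewrite divfK// gt_eqF// addr_gt0// ltr_wpDl.
have h : `|series (u \* phi j) n.+1| @[n --> \oo] --> `|L j|.
  by apply: cvg_norm; rewrite (cvg_shiftS (series (u \* phi j))); exact: uL.
rewrite -(cvg_lim _ h)//; apply: limr_le; first by apply/cvg_ex; eexists; exact: h.
near=> n.
have uS k : (N <= k)%N -> `|series u k| <= d by move/uN; rewrite /= sub0r normrN.
have Nn : (N <= n)%N by near: n; exists N.
rewrite abel_summation (le_trans (ler_normD _ _))// !mulrDr !mulr1 lerD//; last first.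
  rewrite normrM -[leRHS]mulr1 ler_pM// uS//; exact: leqW.
rewrite (le_trans (ler_norm_sum _ _ _))// (big_cat_nat (n:=N))//= addrC lerD//.
- rewrite (@le_trans _ _ (\sum_(N <= k < n) d * `|phi j k - phi j k.+1|))//.
    rewrite ler_sum_nat// => k /andP[Nk _]; rewrite normrM ler_wpM2r// uS//.
    exact: leqW.
  rewrite -mulr_sumr ler_wpM2l// ?(ltW d0)// (le_trans _ (phiV j n))//.
  by rewrite [leRHS](big_cat_nat (n:=N))//= lerDr sumr_ge0.
- under eq_bigr do rewrite normrM.
  suff : `|0 - A j| <= d by rewrite sub0r normrN; exact/le_trans/ler_norm.
  by near: j.
Unshelve. all: by end_near. Qed.

End Summation.

(** * Riemann's kernel and the generalized second derivative *)

Section RiemannKernel.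
Context {R : realType}.
Implicit Types (t x : R) (j k : nat).

Lemma abs_sin_le x : `|sin x| <= `|x|.
Proof.
wlog x0 : x / 0 < x => [h|].
  have [xN|/h//|->] := ltgtP x 0; last by rewrite sin0 normr0.
  by rewrite -normrN -sinN -[leRHS]normrN h// oppr_gt0.
have csin : {within `[0, x], continuous (@sin R)}.
  by apply: continuous_subspaceT => y; exact: continuous_sin.
have [c _] := MVT x0 (fun y _ => is_derive_sin y) csin.
by rewrite sin0 !subr0 => ->; rewrite normrM ler_piMl// cos_max.
Qed.

Definition sinc t : R := if t == 0 then 1 else sin t / t.

Lemma sincE t : t != 0 -> sinc t = sin t / t.
Proof. by rewrite /sinc => /negbTE ->. Qed.

Lemma sinc0 : sinc 0 = 1.
Proof. by rewrite /sinc eqxx. Qed.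

Lemma abs_sinc_le1 t : `|sinc t| <= 1.
Proof.
rewrite /sinc; case: eqVneq => t0; first by rewrite normr1.
by rewrite normrM normfV ler_pdivrMr ?normr_gt0// mul1r abs_sin_le.
Qed.

Lemma sinc_cvg : sinc t @[t --> (0 : R)^'] --> (1 : R).
Proof.
have [ds dE] := @is_derive_sin R 0.
have d1 : h^-1 *: (sin (h *: 1 + 0) - sin 0) @[h --> (0 : R)^'] --> (1 : R).
  move: ds; rewrite /derivable -/(derive _ _ _) dE cos0. exact.
apply: cvg_trans d1; apply: near_eq_cvg.
near=> t; have t0 : t != 0 by near: t; exact: nbhs_dnbhs_neq.
by rewrite /= sincE// /GRing.scale/= mulr1 addr0 sin0 subr0 mulrC.
Unshelve. all: by end_near. Qed.

Definition mesh j : R := j.+1%:R^-1.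

Lemma mesh_gt0 j : 0 < mesh j.
Proof. by rewrite invr_gt0. Qed.

Lemma mesh_cvg0 : mesh @ \oo --> (0 : R).
Proof. exact: cvg_harmonic. Qed.

(** The weights by which the second symmetric difference quotient multiplies the
terms of a trigonometric series. *)
Definition riemann_kernel j k : R := sinc (k%:R * mesh j) ^+ 2.

Lemma riemann_kernel_cvg k : riemann_kernel j k @[j --> \oo] --> (1 : R).
Proof.
rewrite /riemann_kernel; have [->|k0] := eqVneq k 0%N.
  under eq_fun do rewrite mul0r sinc0 expr1n.
  exact: cvg_cst.
suff h : sinc (k%:R * mesh j) @[j --> \oo] --> (1 : R).
  under eq_fun do rewrite expr2.
  have := cvgM h h; rewrite mulr1; exact.
apply: (cvg_comp _ _ _ sinc_cvg).
have h : (k%:R * mesh j) @[j --> \oo] --> (0 : R).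
  by rewrite -(mulr0 k%:R); apply: cvgMr; exact: mesh_cvg0.
move=> A /= [e e0 eA].
have /cvgrPdist_lt/(_ e e0) := h; apply: filterS => j hj.
apply: eA => //=.
by rewrite mulf_neq0// ?pnatr_eq0// gt_eqF ?mesh_gt0.
Qed.

Lemma riemann_kernel_le1 j k : `|riemann_kernel j k| <= 1.
Proof. by rewrite normrX expr_le1// abs_sinc_le1. Qed.

Section Step.
Variable j : nat.
Let d := mesh j.
Let d0 : 0 < d. Proof. exact: mesh_gt0. Qed.
Let dJ : j.+1%:R * d = 1. Proof. by rewrite /d /mesh divff. Qed.

Let kd_le1 k : (k <= j.+1)%N -> 0 <= k%:R * d <= 1.
Proof.
move=> kj; rewrite mulr_ge0 ?(ltW d0)//= -[leRHS]dJ.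
by rewrite ler_wpM2r ?(ltW d0)// ler_nat.
Qed.

Let trig_ge0 t : 0 <= t <= 1 -> 0 <= sin t /\ 0 <= cos t.
Proof.
move=> /andP[t0 t1]; have p1 := @pihalf_ge1 R; split.
  by rewrite sin_ge0_pi// t0/=; lra.
by apply: cos_ge0_pihalf; apply/andP; split; lra.
Qed.

(** A discrete form of t cos t <= sin t: it makes sin(kd)/k decrease in k by
the addition formula alone. *)
Let sin_step k : (k <= j.+1)%N -> k%:R * cos (k%:R * d) * sin d <= sin (k%:R * d).
Proof.
have [sd cd] : 0 <= sin d /\ 0 <= cos d.
  by apply: trig_ge0; have := @kd_le1 1; rewrite mul1r; apply.
elim: k => [_|k IH kj]; first by rewrite !mul0r sin0.
have [sk ck] := trig_ge0 (kd_le1 (ltnW kj)).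
have {IH} := ler_wpM2r cd (IH (ltnW kj)).
rewrite -[k.+1%:R]natr1 [(k%:R + 1) * d]mulrDl mul1r sinD cosD.
have c1 := @cos_le1 R d.
have h1 : 0 <= k.+1%:R * sin (k%:R * d) * sin d * sin d by rewrite !mulr_ge0.
have h2 : 0 <= cos (k%:R * d) * sin d * (1 - cos d).
  by rewrite !mulr_ge0// subr_ge0.
move: h1; rewrite -[k.+1%:R]natr1.
set c := cos (k%:R * d); set s := sin (k%:R * d); set s1 := sin d.
set c1' := cos d; set K := k%:R => h1 h3.
have : 0 <= c * s1 * (1 - c1') := h2.
nra.
Qed.

Let kernel_decr k : (k <= j)%N -> riemann_kernel j k.+1 <= riemann_kernel j k.
Proof.
move=> kj; have [->|k0] := eqVneq k 0%N.
  rewrite {2}/riemann_kernel mul0r sinc0 expr1n.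
  exact: le_trans (ler_norm _) (riemann_kernel_le1 _ _).
have kR : 0 < k%:R :> R by rewrite ltr0n lt0n.
have kd0 : 0 < k%:R * d by rewrite mulr_gt0.
have k1d0 : 0 < k.+1%:R * d by rewrite mulr_gt0.
have [sk ck] := trig_ge0 (kd_le1 (leqW kj)).
have [sk1 ck1] := @trig_ge0 (k.+1%:R * d) (@kd_le1 k.+1 kj).
have [sd _] : 0 <= sin d /\ 0 <= cos d.
  by apply: trig_ge0; have := @kd_le1 1; rewrite mul1r; apply.
rewrite /riemann_kernel !sincE ?gt_eqF// lerXn2r ?nnegrE//.
- by rewrite divr_ge0// ltW.
- by rewrite divr_ge0// ltW.
rewrite ler_pdivrMr// mulrAC ler_pdivlMr//.
rewrite !mulrA ler_pM2r// -natr1 mulrDl mul1r sinD mulrDr mulr1 mulrDl lerD//.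
  by rewrite mulrAC ler_piMr ?cos_le1// mulr_ge0.
have := sin_step (leqW kj); lra.
Qed.

(** Beyond k d = 1 both sources of variation, the change of the sine and that of
the denominator, are bounded by telescoping differences. *)
Let kernel_tail k : (j < k)%N ->
  `|riemann_kernel j k - riemann_kernel j k.+1| <=
  (2 * j.+1%:R / k%:R + j.+1%:R ^+ 2 / k%:R ^+ 2) -
  (2 * j.+1%:R / k.+1%:R + j.+1%:R ^+ 2 / k.+1%:R ^+ 2).
Proof.
move=> jk; have kR : 0 < k%:R :> R by rewrite ltr0n; case: k jk.
have k1R : 0 < k.+1%:R :> R by [].
have kd0 : 0 < k%:R * d by rewrite mulr_gt0.
have k1d0 : 0 < k.+1%:R * d by rewrite mulr_gt0.
have dE : d = j.+1%:R^-1 by [].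
rewrite /riemann_kernel -/d !sincE ?gt_eqF//.
set a := k%:R * d; set b := k.+1%:R * d; rewrite 2!(expr_div_n (sin _)).
have ab : b - a = d by rewrite /a /b -natr1; ring.
have h1 : `|sin a ^+ 2 - sin b ^+ 2| <= d.
  have -> : sin a ^+ 2 - sin b ^+ 2 = - (sin (b - a) * sin (b + a)).
    rewrite sinB sinD [RHS](_ : _ = sin a ^+ 2 * cos b ^+ 2 -
      sin b ^+ 2 * cos a ^+ 2); last by ring.
    by rewrite !cos2sin2; ring.
  rewrite normrN normrM ab -[leRHS]mulr1 ler_pM// ?sin_max//.
  by rewrite (le_trans (abs_sin_le _))// ger0_norm// ltW.
have -> : sin a ^+ 2 / a ^+ 2 - sin b ^+ 2 / b ^+ 2 =
   (sin a ^+ 2 - sin b ^+ 2) / a ^+ 2 + sin b ^+ 2 * (a ^- 2 - b ^- 2) by ring.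
have aE : a ^- 2 = j.+1%:R ^+ 2 / k%:R ^+ 2.
  by rewrite /a exprMn invfM dE exprVn invrK mulrC.
have bE : b ^- 2 = j.+1%:R ^+ 2 / k.+1%:R ^+ 2.
  by rewrite /b exprMn invfM dE exprVn invrK mulrC.
have ba2 : b ^- 2 <= a ^- 2.
  rewrite lef_pV2 ?posrE ?exprn_gt0// lerXn2r ?nnegrE ?(ltW kd0) ?(ltW k1d0)//.
  by rewrite -subr_ge0 ab ltW.
rewrite (le_trans (ler_normD _ _))//.
rewrite [leRHS](_ : _ = 2 * j.+1%:R * (k%:R^-1 - k.+1%:R^-1) + (a ^- 2 - b ^- 2)); last first.
  by rewrite aE bE; ring.
apply: lerD.
- rewrite normrM (@ger0_norm _ (a ^- 2)) ?invr_ge0 ?sqr_ge0//.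
  rewrite (@le_trans _ _ (d * a ^- 2))//.
    by rewrite ler_wpM2r// invr_ge0 sqr_ge0.
  have -> : d * a ^- 2 = j.+1%:R * k%:R ^- 2.
    by rewrite aE dE expr2 !mulrA mulVf// mul1r.
  rewrite [leRHS](_ : _ = j.+1%:R * ((k%:R^-1 - k.+1%:R^-1) * 2)); last by ring.
  rewrite ler_wpM2l//.
  have -> : (k%:R^-1 - k.+1%:R^-1) * 2 = 2 / (k%:R * k.+1%:R) :> R.
    rewrite -natr1; field; rewrite gt_eqF//=; lra.
  have k1 : 1 <= k%:R :> R by rewrite ler1n -(ltr0n R).
  rewrite -subr_ge0 [leRHS](_ : _ = (k%:R - 1) / (k%:R ^+ 2 * k.+1%:R)).
    by rewrite divr_ge0 ?subr_ge0// mulr_ge0// sqr_ge0.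
  by rewrite -[k.+1%:R]natr1; field; rewrite gt_eqF//=; lra.
- rewrite normrM ger0_norm ?sqr_ge0// ger0_norm ?subr_ge0//.
  by rewrite ler_piMl ?subr_ge0// -[leLHS]ger0_norm ?sqr_ge0// normrX expr_le1// sin_max.
Qed.

(** Up to k d = 1 the kernel decreases from 1, which contributes at most 1; beyond,
the majorant of [kernel_tail] telescopes to at most 3. *)
Lemma riemann_kernel_variation n :
  \sum_(0 <= k < n) `|riemann_kernel j k - riemann_kernel j k.+1| <= 4.
Proof.
rewrite (@le_trans _ _ (\sum_(0 <= k < j.+1 + n)
   `|riemann_kernel j k - riemann_kernel j k.+1|))//.
  rewrite [leRHS](big_cat_nat (n := n))//= ?leq_addl// lerDl sumr_ge0//.
rewrite (big_cat_nat (n := j.+1))//= ?leq_addr//.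
have -> : 4 = 1 + 3 :> R by ring.
apply: lerD.
- under eq_big_nat => k /andP[_ kj] do rewrite ger0_norm ?subr_ge0 ?kernel_decr//.
  rewrite -[leLHS]opprK -sumrN; under eq_bigr do rewrite opprB.
  rewrite telescope_sumr// opprB {1}/riemann_kernel mul0r sinc0 expr1n.
  by rewrite gerBl sqr_ge0.
- pose F k : R := - (2 * j.+1%:R / k%:R + j.+1%:R ^+ 2 / k%:R ^+ 2).
  rewrite (@le_trans _ _ (\sum_(j.+1 <= k < j.+1 + n) (F k.+1 - F k)))//.
    apply: ler_sum_nat => k /andP[jk _].
    by rewrite (le_trans (kernel_tail jk))// /F opprK addrC.
  rewrite telescope_sumr ?leq_addr// /F opprK.
  rewrite mulfK// divff// addrC (_ : 2 + 1 = 3 :> R); last by ring.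
  by rewrite gerBl addr_ge0// divr_ge0// ?mulr_ge0// sqr_ge0.
Qed.

End Step.

End RiemannKernel.

Section SecondDifference.
Context {R : realType}.

(** If f were negative somewhere, then so would be f plus a small multiple of
(x - a) (b - x). At an interior minimum of the latter the second difference
quotients are nonnegative, although they tend to a negative number. The same applies to
- f. *)
Lemma schwarz_zero (f : R -> R) (a b : R) (h : nat -> R) :
  {within `[a, b], continuous f} -> f a = 0 -> f b = 0 ->
  (forall n, 0 < h n) -> h @ \oo --> (0 : R) ->
  (forall x, a < x < b ->
     (f (x + h n) + f (x - h n) - 2 * f x) / h n ^+ 2 @[n --> \oo] --> (0 : R)) ->
  forall x, a <= x <= b -> f x = 0.
Proof.
move=> cf fa fb h0 h_to0.
have main (g : R -> R) : {within `[a, b], continuous g} -> g a = 0 -> g b = 0 ->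
    (forall x, a < x < b ->
     (g (x + h n) + g (x - h n) - 2 * g x) / h n ^+ 2 @[n --> \oo] --> (0 : R)) ->
    forall x, a <= x <= b -> 0 <= g x.
  move=> cg ga gb g2 c acb; rewrite leNgt; apply/negP => gc.
  have ac : a < c.
    rewrite lt_neqAle (andP acb).1 andbT; apply/eqP => ac.
    by move: gc; rewrite -ac ga ltxx.
  have cb : c < b.
    rewrite lt_neqAle (andP acb).2 andbT; apply/eqP => cb.
    by move: gc; rewrite cb gb ltxx.
  have q0 : 0 < (c - a) * (b - c) by rewrite mulr_gt0 ?subr_gt0.
  (* Raises the value at c by half of what would bring it to 0. *)
  pose e := - g c / ((c - a) * (b - c)) / 2.
  have e0 : 0 < e by rewrite !divr_gt0// oppr_gt0.
  pose H : R -> R := g + (fun x => e * ((x - a) * (b - x))).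
  have HE x : H x = g x + e * ((x - a) * (b - x)) by [].
  have cH : {within `[a, b], continuous H}.
    move=> x; apply: (@continuousD R R^o (subspace `[a, b])); first exact: cg.
    apply: continuous_subspaceT => y.
    apply: cvgMr; apply: cvgM; first by apply: cvgB; [exact: cvg_id|exact: cvg_cst].
    by apply: cvgB; [exact: cvg_cst|exact: cvg_id].
  have [m mab Hm] := EVT_min (ltW (lt_trans ac cb)) cH.
  have Hc : H c < 0.
    have -> : H c = g c / 2.
      by rewrite HE /e; field; rewrite gt_eqF ?subr_gt0//= gt_eqF ?subr_gt0.
    by rewrite pmulr_llt0.
  have Hm0 : H m < 0 by rewrite (le_lt_trans _ Hc)// Hm// in_itv/= acb.
  have Ha : H a = 0 by rewrite HE ga subrr; ring.
  have Hb : H b = 0 by rewrite HE gb subrr; ring.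
  move: mab; rewrite in_itv/= => /andP[am mb].
  have am' : a < m.
    by rewrite lt_neqAle am andbT; apply/eqP => E; move: Hm0; rewrite -E Ha ltxx.
  have mb' : m < b.
    by rewrite lt_neqAle mb andbT; apply/eqP => E; move: Hm0; rewrite E Hb ltxx.
  have := g2 m; rewrite am' mb' => /(_ isT) /cvgrPdist_lt/(_ _ e0) gm.
  pose r := Num.min (m - a) (b - m).
  have r0 : 0 < r by rewrite lt_min !subr_gt0 am' mb'.
  have /cvgrPdist_lt/(_ _ r0) hr := h_to0.
  have [n [hn gn]] : exists n, `|0 - h n| < r /\
     `|0 - (g (m + h n) + g (m - h n) - 2 * g m) / h n ^+ 2| < e.
    have [N _ NP] : \forall n \near \oo, `|0 - h n| < r /\
       `|0 - (g (m + h n) + g (m - h n) - 2 * g m) / h n ^+ 2| < e.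
      by apply: filterS2 hr gm.
    by exists N; apply: NP => /=.
  move: hn; rewrite sub0r normrN gtr0_norm// lt_min => /andP[h1 h2].
  have hp := h0 n.
  have Hp : H m <= H (m + h n) by apply: Hm; rewrite in_itv/=; apply/andP; split; lra.
  have Hn : H m <= H (m - h n) by apply: Hm; rewrite in_itv/=; apply/andP; split; lra.
  move: gn; rewrite sub0r normrN; apply/negP; rewrite -leNgt.
  rewrite (le_trans _ (ler_norm _))// ler_pdivlMr ?exprn_gt0//.
  have := mulr_ge0 (ltW e0) (sqr_ge0 (h n)).
  move: Hp Hn; rewrite !HE; nra.
move=> f2 x xab; apply/eqP; rewrite eq_le; apply/andP; split; last exact: (main f).
rewrite -oppr_ge0; apply: (main (fun x => - f x)) => //.
- by move=> y; apply: (@continuousN R R^o (subspace `[a, b])); exact: cf.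
- by rewrite fa oppr0.
- by rewrite fb oppr0.
- move=> y /f2 fy; rewrite -oppr0.
  rewrite (_ : (fun n => _) =
      (fun n => - ((f (y + h n) + f (y - h n) - 2 * f y) / h n ^+ 2))).
    exact: cvgN.
  by apply/funext => n; ring.
Qed.

End SecondDifference.

(** * The trigonometric system on [-l, l[ *)

Section TrigonometricSeries.
Context {R : realType} (l : R).
Hypothesis l_gt0 : 0 < l.
Local Notation mu := (@lebesgue_measure R).
Local Notation "'I' f" := (\int[mu]_(x in itvl l) f x) (at level 10, f at level 8).
Local Notation arg k x := (k%:R * pi * x / l).
Implicit Types (a b : nat -> R) (f g : R -> R).

Let l_neq0 : l != 0. Proof. by rewrite gt_eqF. Qed.

Lemma itvl_measure : mu (itvl l) = (2 * l)%:E.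
Proof.
rewrite /itvl lebesgue_measure_itv/= lte_fin ifT; last by move: l_gt0; lra.
by rewrite -EFinB opprK mulr_natl mulr2n.
Qed.

Lemma itvl_lty : (mu (itvl l) < +oo)%E.
Proof. by rewrite itvl_measure ltry. Qed.

Lemma itvl_measurable : measurable (itvl l).
Proof. exact: measurable_itv. Qed.

Lemma continuous_itvl_integrable f :
  continuous f -> mu.-integrable (itvl l) (EFin \o f).
Proof.
move=> cf; apply: (@integrableS _ _ _ mu `[- l, l]%classic) => //.
- exact: itvl_measurable.
- by apply/subset_itvP; exact: subset_itv_co_cc.
- apply: continuous_compact_integrable; first exact: segment_compact.
  exact: continuous_subspaceT.
Qed.

Lemma bcfun_mul_integrable (f : bcfun l) g : continuous g -> (forall x, `|g x| <= 1) ->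
  mu.-integrable (itvl l) (EFin \o (fun x => f x * g x)).
Proof.
move=> cg g1; apply: measurable_bounded_integrable.
- exact: itvl_measurable.
- exact: itvl_lty.
- have /set_mem[cf _ _] := bcfun_prop f.
  have ml := itvl_measurable.
  apply: measurable_funM; first exact: subspace_continuous_measurable_fun.
  apply: subspace_continuous_measurable_fun => //.
  exact: continuous_subspaceT.
- have /set_mem[_ [M fM] _] := bcfun_prop f.
  exists M; split; first exact: num_real.
  move=> r Mr x lx; apply: (le_trans _ (ltW Mr)); apply: (le_trans _ (fM x lx)).
  by rewrite normrM ler_piMr.
Qed.

Lemma arg_continuous k : continuous (fun x => arg k x).
Proof.
move=> x; apply: cvgMl; apply: cvgMr; exact: cvg_id.
Qed.

Lemma cos_arg_continuous k : continuous (fun x => cos (arg k x)).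
Proof.
move=> x; apply: (cvg_comp (fun x => arg k x) cos); first exact: arg_continuous.
exact: continuous_cos.
Qed.

Lemma sin_arg_continuous k : continuous (fun x => sin (arg k x)).
Proof.
move=> x; apply: (cvg_comp (fun x => arg k x) sin); first exact: arg_continuous.
exact: continuous_sin.
Qed.

Lemma sin_nat_pi k : sin (k%:R * pi) = 0 :> R.
Proof.
elim: k => [|k IH]; first by rewrite mul0r sin0.
by rewrite -natr1 mulrDl mul1r sinDpi IH oppr0.
Qed.

Lemma sin_arg_end k : sin (arg k l) = 0.
Proof. by rewrite mulfK// sin_nat_pi. Qed.

Lemma arg_shift k x : arg k (x + 2 * l) = arg k x + (pi *+ 2) *+ k.
Proof. by rewrite -mulr_natl -(mulr_natl _ k); field. Qed.

Lemma cos_arg_shift k x : cos (arg k (x + 2 * l)) = cos (arg k x).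
Proof. by rewrite arg_shift (periodicn (@cosD2pi R)). Qed.

Lemma sin_arg_shift k x : sin (arg k (x + 2 * l)) = sin (arg k x).
Proof. by rewrite arg_shift (periodicn (@sinD2pi R)). Qed.

Lemma Rintegral_itvl_FTC f F : continuous f ->
  (forall x : R, is_derive x 1 F (f x)) -> I f = F l - F (- l).
Proof.
move=> cf dF.
have cF : continuous F.
  by move=> x; apply: differentiable_continuous; apply/derivable1_diffP; case: (dF x).
rewrite /itvl Rintegral_itv_bndo_bndc; last exact: continuous_itvl_integrable.
rewrite /Rintegral (@continuous_FTC2 _ f F)//.
- by move: l_gt0; lra.
- exact: continuous_subspaceT.
- split => [x _||]; first by case: (dF x).
  + apply: cvg_at_right_filter; exact: cF.
  + apply: cvg_at_left_filter; exact: cF.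
- by move=> x _; rewrite derive1E; case: (dF x).
Qed.

Lemma integral_cos k : (0 < k)%N -> I (fun x => cos (arg k x)) = 0.
Proof.
move=> k0; pose c := k%:R * pi / l.
have c0 : c != 0.
  by rewrite !mulf_neq0// ?invr_eq0// ?pnatr_eq0 -?lt0n// gt_eqF// pi_gt0.
pose F (x : R) : R := c^-1 * sin (arg k x).
have dF (x : R) : is_derive x 1 F (cos (arg k x)).
  have -> : F = c^-1 *: (sin \o (c *: id)).
    apply/funext => y /=; rewrite /F /GRing.scale/= /c.
    by congr (_ * _); congr sin; rewrite /GRing.scale/=; ring.
  apply: is_derive_eq => /=.
  rewrite /GRing.scale/= mulr1 mulrA mulrAC mulVf// mul1r.
  congr cos. rewrite /GRing.scale/= /c; ring.
rewrite (Rintegral_itvl_FTC (@cos_arg_continuous k) dF).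
by rewrite /F mulrN mulNr sinN sin_arg_end; ring.
Qed.

Lemma integral_sin k : I (fun x => sin (arg k x)) = 0.
Proof.
have [->|k0] := eqVneq k 0%N.
  under eq_Rintegral do rewrite !mul0r sin0.
  by rewrite Rintegral_cst ?mul0r//; exact: itvl_measurable.
pose c := k%:R * pi / l.
have c0 : c != 0.
  by rewrite !mulf_neq0// ?invr_eq0// ?pnatr_eq0// gt_eqF// pi_gt0.
pose F (x : R) : R := - c^-1 * cos (arg k x).
have dF (x : R) : is_derive x 1 F (sin (arg k x)).
  have -> : F = (- c^-1) *: (cos \o (c *: id)).
    apply/funext => y /=; rewrite /F /GRing.scale/= /c.
    by congr (_ * _); congr cos; rewrite /GRing.scale/=; ring.
  apply: is_derive_eq => /=.
  have -> : (c *: (id : R -> R)) x = arg k x by transitivity (c * x) => //; rewrite /c; ring.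
  by rewrite /GRing.scale/= mulr1 !mulNr mulrN opprK mulrCA mulVf// mulr1.
rewrite (Rintegral_itvl_FTC (@sin_arg_continuous k) dF).
rewrite /F (_ : arg k (- l) = - arg k l); last by ring.
by rewrite cosN subrr.
Qed.

Lemma Rintegral_itvl_add f g : continuous f -> continuous g ->
  I (fun x => f x + g x) = I f + I g.
Proof.
by move=> cf cg; rewrite RintegralD//;
  first [exact: itvl_measurable | exact: continuous_itvl_integrable].
Qed.

Lemma Rintegral_itvl_scale (c : R) f : continuous f ->
  I (fun x => c * f x) = c * I f.
Proof.
by move=> cf; rewrite RintegralZl//;
  first [exact: itvl_measurable | exact: continuous_itvl_integrable].
Qed.

Let continuousZ (c : R) f : continuous f -> continuous (fun x => c * f x).
Proof. by move=> cf x; apply: cvgMr; exact: cf. Qed.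

Let continuousDf f g : continuous f -> continuous g -> continuous (fun x => f x + g x).
Proof. by move=> cf cg x; apply: cvgD; [exact: cf|exact: cg]. Qed.

Let continuousMf f g : continuous f -> continuous g -> continuous (fun x => f x * g x).
Proof. by move=> cf cg x; apply: cvgM; [exact: cf|exact: cg]. Qed.

Let argD j k x : arg (j + k) x = arg j x + arg k x.
Proof. by rewrite natrD; ring. Qed.

Let argB j k x : (j <= k)%N -> arg (k - j) x = arg k x - arg j x.
Proof. by move=> jk; rewrite natrB//; ring. Qed.

Lemma integral_one : I (fun=> 1) = 2 * l.
Proof.
rewrite Rintegral_cst ?mul1r; last exact: itvl_measurable.
transitivity (fine (2 * l)%:E) => //; congr fine; exact: itvl_measure.
Qed.

Lemma integral_cos0 k : I (fun x => cos (arg k x)) = if k == 0%N then 2 * l else 0.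
Proof.
case: eqP => [->|/eqP k0]; last by rewrite integral_cos// lt0n.
by rewrite -integral_one; apply: eq_Rintegral => x _; rewrite !mul0r cos0.
Qed.

Lemma integral_coscos j k : (0 < k)%N ->
  I (fun x => cos (arg j x) * cos (arg k x)) = if j == k then l else 0.
Proof.
have main i n : (i <= n)%N -> (0 < n)%N ->
    I (fun x => cos (arg i x) * cos (arg n x)) = if i == n then l else 0.
  move=> le_in n0.
  transitivity (I (fun x => 2^-1 * cos (arg (i + n) x) + 2^-1 * cos (arg (n - i) x))).
    apply: eq_Rintegral => x _; rewrite argD argB// cosD cosB; lra.
  rewrite Rintegral_itvl_add; [|apply: continuousZ; exact: cos_arg_continuous..].
  rewrite !Rintegral_itvl_scale; [|exact: cos_arg_continuous..].
  rewrite integral_cos ?addn_gt0 ?n0 ?orbT// mulr0 add0r integral_cos0.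
  rewrite subn_eq0 eqn_leq le_in/=; case: ifP => _; last by rewrite mulr0.
  by lra.
move=> k0; have [jk|kj] := leqP j k; first exact: main.
rewrite gtn_eqF//; under eq_Rintegral do rewrite mulrC.
by rewrite main ?(ltnW kj) ?(ltn_trans k0 kj)// ltn_eqF.
Qed.

Lemma integral_sinsin j k : (0 < k)%N ->
  I (fun x => sin (arg j x) * sin (arg k x)) = if j == k then l else 0.
Proof.
have main i n : (i <= n)%N -> (0 < n)%N ->
    I (fun x => sin (arg i x) * sin (arg n x)) = if i == n then l else 0.
  move=> le_in n0.
  transitivity (I (fun x => - 2^-1 * cos (arg (i + n) x) + 2^-1 * cos (arg (n - i) x))).
    apply: eq_Rintegral => x _; rewrite argD argB// cosD cosB; lra.
  rewrite Rintegral_itvl_add; [|apply: continuousZ; exact: cos_arg_continuous..].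
  rewrite !Rintegral_itvl_scale; [|exact: cos_arg_continuous..].
  rewrite integral_cos ?addn_gt0 ?n0 ?orbT// mulr0 add0r integral_cos0.
  rewrite subn_eq0 eqn_leq le_in/=; case: ifP => _; last by rewrite mulr0.
  by lra.
move=> k0; have [jk|kj] := leqP j k; first exact: main.
rewrite gtn_eqF//; under eq_Rintegral do rewrite mulrC.
by rewrite main ?(ltnW kj) ?(ltn_trans k0 kj)// ltn_eqF.
Qed.

Lemma integral_sincos j k : I (fun x => sin (arg j x) * cos (arg k x)) = 0.
Proof.
have [jk|/ltnW kj] := leqP j k.
- transitivity (I (fun x => 2^-1 * sin (arg (j + k) x) + - 2^-1 * sin (arg (k - j) x))).
    apply: eq_Rintegral => x _; rewrite argD argB// sinD sinB; lra.
  rewrite Rintegral_itvl_add; [|apply: continuousZ; exact: sin_arg_continuous..].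
  rewrite !Rintegral_itvl_scale; [|exact: sin_arg_continuous..].
  by rewrite !integral_sin; lra.
- transitivity (I (fun x => 2^-1 * sin (arg (j + k) x) + 2^-1 * sin (arg (j - k) x))).
    apply: eq_Rintegral => x _; rewrite argD argB// sinD sinB; lra.
  rewrite Rintegral_itvl_add; [|apply: continuousZ; exact: sin_arg_continuous..].
  rewrite !Rintegral_itvl_scale; [|exact: sin_arg_continuous..].
  by rewrite !integral_sin; lra.
Qed.

Definition trig a b k x : R := a k * cos (arg k x) + b k * sin (arg k x).

Lemma trig_continuous a b k : continuous (trig a b k).
Proof.
apply: continuousDf; apply: continuousZ;
  [exact: cos_arg_continuous|exact: sin_arg_continuous].
Qed.

Lemma trig0 a b x : trig a b 0%N x = a 0%N.
Proof. by rewrite /trig !mul0r cos0 sin0 mulr1 mulr0 addr0. Qed.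

Lemma trig_shift a b k x : trig a b k (x + 2 * l) = trig a b k x.
Proof. by rewrite /trig cos_arg_shift sin_arg_shift. Qed.

Lemma integral_trig_cos a b k j : (0 < j)%N ->
  I (fun x => trig a b k x * cos (arg j x)) = if k == j then l * a j else 0.
Proof.
move=> j0.
transitivity (I (fun x => a k * (cos (arg k x) * cos (arg j x)) +
                          b k * (sin (arg k x) * cos (arg j x)))).
  by apply: eq_Rintegral => x _; rewrite /trig; ring.
have c1 := continuousMf (@cos_arg_continuous k) (@cos_arg_continuous j).
have c2 := continuousMf (@sin_arg_continuous k) (@cos_arg_continuous j).
rewrite Rintegral_itvl_add; [|exact: continuousZ..].
rewrite !Rintegral_itvl_scale// integral_coscos// integral_sincos mulr0 addr0.
by case: eqP => [->|_]; rewrite ?mulr0// mulrC.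
Qed.

Lemma integral_trig_sin a b k j : (0 < j)%N ->
  I (fun x => trig a b k x * sin (arg j x)) = if k == j then l * b j else 0.
Proof.
move=> j0.
transitivity (I (fun x => a k * (sin (arg j x) * cos (arg k x)) +
                          b k * (sin (arg k x) * sin (arg j x)))).
  by apply: eq_Rintegral => x _; rewrite /trig; ring.
have c1 := continuousMf (@sin_arg_continuous j) (@cos_arg_continuous k).
have c2 := continuousMf (@sin_arg_continuous k) (@sin_arg_continuous j).
rewrite Rintegral_itvl_add; [|exact: continuousZ..].
rewrite !Rintegral_itvl_scale// integral_sinsin// integral_sincos mulr0 add0r.
by case: eqP => [->|_]; rewrite ?mulr0// mulrC.
Qed.

Lemma integral_trig_sqr a b k : (0 < k)%N ->
  I (fun x => trig a b k x ^+ 2) = l * (a k ^+ 2 + b k ^+ 2).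
Proof.
move=> k0.
transitivity (I (fun x => a k * (trig a b k x * cos (arg k x)) +
                          b k * (trig a b k x * sin (arg k x)))).
  by apply: eq_Rintegral => x _; rewrite {1}/trig expr2 mulrDl; rewrite /trig; ring.
have c1 := continuousMf (@trig_continuous a b k) (@cos_arg_continuous k).
have c2 := continuousMf (@trig_continuous a b k) (@sin_arg_continuous k).
rewrite Rintegral_itvl_add; [|exact: continuousZ..].
rewrite !Rintegral_itvl_scale// integral_trig_cos// integral_trig_sin// eqxx.
ring.
Qed.

Lemma trig_sqr_le a b k x : trig a b k x ^+ 2 <= a k ^+ 2 + b k ^+ 2.
Proof.
have := cos2Dsin2 (arg k x); rewrite /trig.
move: (cos _) (sin _) => c s cs.
have -> : a k ^+ 2 + b k ^+ 2 = (a k ^+ 2 + b k ^+ 2) * (c ^+ 2 + s ^+ 2).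
  by rewrite cs mulr1.
have := sqr_ge0 (a k * s - b k * c); nra.
Qed.

(** With r the sum of the squares of the coefficients, the squares of the terms
divided by 1 + r are bounded by 1 and tend to 0 pointwise, so by dominated
convergence their integrals l r / (1 + r) tend to 0. *)
Lemma cantor_lebesgue_bounded a b :
  (forall x, itvl l x -> trig a b k x @[k --> \oo] --> (0 : R)) ->
  exists2 C, 0 <= C & forall k, `|a k| <= C /\ `|b k| <= C.
Proof.
move=> t0; pose r k := a k ^+ 2 + b k ^+ 2.
have r0 k : 0 <= r k by rewrite addr_ge0// sqr_ge0.
have r1 k : 0 < 1 + r k by rewrite ltr_wpDr.
pose f k x := (1 + r k)^-1 * trig a b k x ^+ 2.
have fc k : continuous (f k).
  apply: continuousZ.
  exact: (continuousMf (@trig_continuous a b k) (@trig_continuous a b k)).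
have f0 k x : 0 <= f k x by rewrite mulr_ge0 ?sqr_ge0// invr_ge0 ltW.
have f1 k x : f k x <= 1.
  rewrite /f mulrC ler_pdivrMr// mul1r (le_trans (trig_sqr_le _ _ _ _))//.
  by rewrite lerDr.
have mf k : measurable_fun (itvl l) (EFin \o f k).
  exact: measurable_int (continuous_itvl_integrable (fc k)).
have m0 : measurable_fun (itvl l) (cst 0%E : R -> \bar R) by [].
have f_cvg : {ae mu, forall x, itvl l x ->
    (fun k => EFin \o f k) ^~ x @ \oo --> (cst 0%E : R -> \bar R) x}.
  apply: aeW => x lx; apply: cvg_EFin; first by apply: nearW.
  have tx := t0 x lx.
  have tx2 : trig a b k x ^+ 2 @[k --> \oo] --> (0 : R).
    under eq_fun do rewrite expr2.
    by rewrite -(mulr0 (0 : R)); exact: cvgM.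
  apply: (squeeze_cvgr _ (cvg_cst (0 : R)) tx2); apply: nearW => k.
  rewrite f0/= /f ler_piMl ?sqr_ge0// invf_le1//; by rewrite lerDl.
have i1 : mu.-integrable (itvl l) (cst 1%E : R -> \bar R).
  exact: (continuous_itvl_integrable (@cst_continuous _ _ (1 : R))).
have f_dom : {ae mu, forall x k, itvl l x ->
    (`|(fun k => EFin \o f k) k x| <= (cst 1%E : R -> \bar R) x)%E}.
  by apply: aeW => x k _ /=; rewrite lee_fin ger0_norm.
have [|||_ _ fI] := @dominated_convergence _ _ R mu (itvl l) itvl_measurable
  (fun k => EFin \o f k) (cst 0%E) (cst 1%E) mf m0;
  [exact: f_cvg|exact: i1|exact: f_dom|].
have : I (f k) @[k --> \oo] --> (0 : R).
  by move: fI; rewrite integral0 => /fine_cvg.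
move=> /cvgrPdist_lt/(_ (l / 2)); rewrite divr_gt0// => /(_ isT)[N _ Nf].
have rN k : (N < k)%N -> r k <= 1.
  move=> Nk; have := Nf k (ltnW Nk); rewrite /= sub0r normrN.
  rewrite Rintegral_itvl_scale; last first.
    exact: (continuousMf (@trig_continuous a b k) (@trig_continuous a b k)).
  rewrite integral_trig_sqr ?(leq_ltn_trans _ Nk)// -/(r k).
  rewrite ger0_norm; last by rewrite mulr_ge0 ?invr_ge0 ?mulr_ge0 ?(ltW (r1 k)) ?(ltW l_gt0).
  rewrite mulrC ltr_pdivrMr//; have := r1 k; have := l_gt0; nra.
pose C := 1 + \sum_(k < N.+1) (`|a k| + `|b k|).
have S0 : 0 <= \sum_(k < N.+1) (`|a k| + `|b k|).
  by rewrite sumr_ge0// => k _; rewrite addr_ge0.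
exists C => [|k]; first by rewrite addr_ge0.
have [kN|Nk] := leqP k N.
  have : `|a k| + `|b k| <= C.
    rewrite /C (bigD1 (Ordinal (kN : (k < N.+1)%N)))//= addrCA lerDl addr_ge0//.
    by rewrite sumr_ge0// => i _; rewrite addr_ge0.
  by have := normr_ge0 (a k); have := normr_ge0 (b k); split; lra.
have C1 : 1 <= C by rewrite lerDl.
have rk := rN k Nk; split; rewrite (le_trans _ C1)//.
- rewrite -(@expr_le1 _ 2)// -normrX ger0_norm ?sqr_ge0// (le_trans _ rk)//.
  by rewrite lerDl sqr_ge0.
- rewrite -(@expr_le1 _ 2)// -normrX ger0_norm ?sqr_ge0// (le_trans _ rk)//.
  by rewrite lerDr sqr_ge0.
Qed.

End TrigonometricSeries.

(** * Cantor's uniqueness theorem *)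

Section CantorUniqueness.
Context {R : realType} (l : R).
Hypothesis l_gt0 : 0 < l.
Variables a b : nat -> R.
Hypothesis series_trig0 : forall x, itvl l x ->
  series (fun k => trig l a b k x) @ \oo --> (0 : R).
Local Notation "'I' f" := (\int[lebesgue_measure]_(x in itvl l) f x)
  (at level 10, f at level 8).
Local Notation arg k x := (k%:R * pi * x / l).

Let u := trig l a b.
(* At k = 0 the denominator vanishes, hence so does the term. *)
Let v k x : R := u k x / k%:R ^+ 2.
Let P x : R := limn (series (v ^~ x)).

Let itvlE x : itvl l x <-> - l <= x < l.
Proof. by rewrite /itvl/= in_itv. Qed.

(** Boundedness of the coefficients makes the twice integrated series converge
uniformly, with remainder of order 1 / n. *)
Let uniform_tail : exists2 C : R, 0 <= C & forall x,
  cvgn (series (v ^~ x)) /\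
  forall n, `|P x - series (v ^~ x) n| <= C / n.+1%:R.
Proof.
have [x lx|C0 C0_ge0 Cab] := @cantor_lebesgue_bounded _ l l_gt0 a b.
  exact: cvg_series_cvg_0 (cvgP _ (series_trig0 lx)).
(* Terms are at most 2 C0 / k^2, and (k + 1) (k + 2) <= 6 k^2 for k > 0. *)
exists (12 * C0) => [|x]; first by rewrite mulr_ge0.
apply: (@series_telescoping_majorant _ (v ^~ x) (fun n => 12 * C0 / n.+1%:R)); last first.
  rewrite -(mulr0 (12 * C0)); apply: cvgMr; exact: cvg_harmonic.
move=> k; rewrite -mulrBr.
have k1 : 0 < k.+1%:R :> R by [].
have k2 : 0 < k.+2%:R :> R by [].
have kB : k.+1%:R^-1 - k.+2%:R^-1 = (k.+1%:R * k.+2%:R)^-1 :> R.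
  rewrite -[k.+2%:R]natr1; field; rewrite gt_eqF//=; lra.
rewrite kB; have [->|k0] := eqVneq k 0%N.
  by rewrite /v expr0n invr0 mulr0 normr0 !mulr_ge0.
have kR : 1 <= k%:R :> R by rewrite ler1n lt0n.
have uC : `|u k x| <= 2 * C0.
  have [aC bC] := Cab k; rewrite /u /trig (le_trans (ler_normD _ _))//.
  have aC' : `|a k * cos (arg k x)| <= C0.
    by rewrite normrM -[leRHS]mulr1 ler_pM// cos_max.
  have bC' : `|b k * sin (arg k x)| <= C0.
    by rewrite normrM -[leRHS]mulr1 ler_pM// sin_max.
  by lra.
rewrite /v normrM normfV normrX normr_nat ler_pdivrMr ?exprn_gt0 ?(lt_le_trans ltr01)//.
rewrite (le_trans uC)// mulrAC ler_pdivlMr ?mulr_gt0//.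
rewrite -[k.+2%:R]natr1 -[k.+1%:R]natr1.
set K := k%:R in kR *.
have : 0 <= C0 * ((K - 1) * (10 * K + 4)) by rewrite !mulr_ge0//; lra.
have -> : C0 * ((K - 1) * (10 * K + 4)) = 12 * C0 * K ^+ 2 - 2 * C0 * ((K + 1) * (K + 1 + 1)).
  ring.
by rewrite subr_ge0.
Qed.

Let series_v_continuous n : continuous (fun x => series (v ^~ x) n).
Proof.
move=> x; rewrite /series/=; apply: cvg_big => [|k _]; first exact: add_continuous.
by apply: cvgMl; exact: trig_continuous.
Qed.

Let P_continuous : continuous P.
Proof.
have [C C0 tail] := uniform_tail.
move=> x; apply/cvgrPdist_le => e e0.
have [n Cn] : exists n : nat, C / n.+1%:R <= e / 3.
  have : C / n.+1%:R @[n --> \oo] --> (0 : R).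
    by rewrite -(mulr0 C); apply: cvgMr; exact: cvg_harmonic.
  move/cvgrPdist_le/(_ (e / 3)); rewrite divr_gt0// => /(_ isT)[N _ NC].
  exists N; have := NC N (leqnn N); rewrite /= sub0r normrN.
  by apply: le_trans; exact: ler_norm.
have /cvgrPdist_le/(_ (e / 3)) := @series_v_continuous n x.
rewrite divr_gt0// => /(_ isT); apply: filterS => y xy.
have hx := (tail x).2 n; have hy := (tail y).2 n.
have -> : P x - P y = (P x - series (v ^~ x) n) +
  ((series (v ^~ x) n - series (v ^~ y) n) - (P y - series (v ^~ y) n)) by ring.
rewrite (le_trans (ler_normD _ _))// [leRHS](_ : e = e / 3 + (e / 3 + e / 3)); last by field.
rewrite lerD ?(le_trans hx)// (le_trans (ler_normB _ _))// lerD// (le_trans hy)//.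
Qed.

Let P_shift x : P (x + 2 * l) = P x.
Proof.
by rewrite /P; under eq_fun do rewrite /v /u trig_shift//.
Qed.

(* The step for which k * pi * h / l is twice k times the mesh. *)
Let h j : R := 2 * l * mesh j / pi.

Let h_gt0 j : 0 < h j.
Proof. by rewrite divr_gt0 ?pi_gt0// !mulr_gt0// mesh_gt0. Qed.

Let h_cvg0 : h @ \oo --> (0 : R).
Proof.
rewrite -(mul0r pi^-1) -(mulr0 (2 * l)); apply: cvgMl; apply: cvgMr.
exact: mesh_cvg0.
Qed.

(** Each term satisfies cos(y + 2s) + cos(y - 2s) - 2 cos y = - 4 cos y (sin s)^2,
and likewise for the sine. The term k = 0 is absent from P but has weight 1 in
the means, whence a 0. *)
Let second_difference x j :
  series ((fun k => u k x) \* riemann_kernel j) @ \oo -->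
  a 0%N - (P (x + h j) + P (x - h j) - 2 * P x) / (4 * mesh j ^+ 2).
Proof.
have [C _ tail] := uniform_tail.
have vP y : series (v ^~ y) @ \oo --> P y by exact: (tail y).1.
have d0 := @mesh_gt0 R j; have p0 := @pi_gt0 R.
have D : (series (v ^~ (x + h j)) n + series (v ^~ (x - h j)) n -
    2 * series (v ^~ x) n) / (4 * mesh j ^+ 2) @[n --> \oo] -->
    (P (x + h j) + P (x - h j) - 2 * P x) / (4 * mesh j ^+ 2).
  apply: cvgMl; apply: cvgB; last by apply: cvgMr; exact: vP.
  by apply: cvgD; exact: vP.
have L : a 0%N - (series (v ^~ (x + h j)) n + series (v ^~ (x - h j)) n -
    2 * series (v ^~ x) n) / (4 * mesh j ^+ 2) @[n --> \oo] -->
    a 0%N - (P (x + h j) + P (x - h j) - 2 * P x) / (4 * mesh j ^+ 2).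
  by apply: cvgB; [exact: cvg_cst|exact: D].
apply: cvg_trans L; apply: near_eq_cvg.
near=> n; have n0 : (0 < n)%N by near: n; exists 1%N.
have v0 y : v 0%N y = 0 by rewrite /v expr0n invr0 mulr0.
have S : \sum_(0 <= k < n) (v k (x + h j) + v k (x - h j) - 2 * v k x) =
    \sum_(1 <= k < n) (v k (x + h j) + v k (x - h j) - 2 * v k x).
  by rewrite big_ltn// !v0 mulr0 subr0 addr0 add0r.
have U : \sum_(0 <= k < n) (u k x * riemann_kernel j k) =
    a 0%N + \sum_(1 <= k < n) (u k x * riemann_kernel j k).
  by rewrite big_ltn// /u trig0 {1}/riemann_kernel mul0r sinc0 expr1n mulr1.
rewrite /= /series/= big_distrr/= -big_split/= -sumrB S U big_distrl/= -sumrN.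
congr (_ + _); apply: eq_big_nat => k /andP[k0 _].
have kR : k%:R != 0 :> R by rewrite pnatr_eq0 -lt0n.
have kd : k%:R * mesh j != 0 :> R by rewrite mulf_neq0// gt_eqF.
rewrite /riemann_kernel sincE// /v /u /trig.
have -> : arg k (x + h j) = arg k x + k%:R * mesh j *+ 2.
  rewrite /h -mulr_natl; move: (@pi R) p0 => p p0; field.
  by rewrite !gt_eqF.
have -> : arg k (x - h j) = arg k x - k%:R * mesh j *+ 2.
  rewrite /h -mulr_natl; move: (@pi R) p0 => p p0; field.
  by rewrite !gt_eqF.
have cT : cos (k%:R * mesh j *+ 2) = 1 - 2 * sin (k%:R * mesh j) ^+ 2 :> R.
  by rewrite cos_mulr2n cos2sin2; ring.
move: (k%:R * mesh j *+ 2) cT => T cT; rewrite cosD cosB sinD sinB cT.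
move: (cos (arg k x)) (sin (arg k x)) (sin T) (sin (k%:R * mesh j)) => c s t' t.
field; by rewrite kR gt_eqF.
Unshelve. all: by end_near. Qed.

Let quotient_cvg x : itvl l x ->
  (P (x + h j) + P (x - h j) - 2 * P x) / h j ^+ 2 @[j --> \oo] -->
  a 0%N * (pi / l) ^+ 2.
Proof.
move=> lx.
have L0 := regular_summation (series_trig0 lx) (@riemann_kernel_cvg R)
  (@riemann_kernel_le1 R) (@riemann_kernel_variation R)
  (fun j => @second_difference x j).
have p0 := @pi_gt0 R.
have L : (a 0%N - (a 0%N - (P (x + h j) + P (x - h j) - 2 * P x) /
    (4 * mesh j ^+ 2))) * (pi / l) ^+ 2 @[j --> \oo] --> (a 0%N - 0) * (pi / l) ^+ 2.
  by apply: cvgMl; apply: cvgB; [exact: cvg_cst|exact: L0].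
rewrite subr0 in L; apply: cvg_trans L; apply: near_eq_cvg; apply: nearW => j /=.
have d0 := @mesh_gt0 R j; rewrite /h; move: (@pi R) p0 => p p0; field.
by rewrite !gt_eqF.
Qed.

(** Subtracting the parabola with the same generalized second derivative leaves a
function to which [schwarz_zero] applies; it vanishes at both ends because P
is periodic. *)
Let P_parabola x : - l <= x <= l ->
  P x = P (- l) + a 0%N * (pi / l) ^+ 2 / 2 * (x ^+ 2 - l ^+ 2).
Proof.
move=> lx; set c := a 0%N * (pi / l) ^+ 2.
pose f y := P y - P (- l) - c / 2 * (y ^+ 2 - l ^+ 2).
have PE : P l = P (- l) by rewrite -(P_shift (- l)); congr P; ring.
suff : f x = 0.
  by move/eqP; rewrite /f subr_eq0 subr_eq addrC => /eqP.
apply: (@schwarz_zero R f (- l) l h) => //.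
- apply: continuous_subspaceT => y; apply: cvgB.
    by apply: cvgB; [exact: P_continuous|exact: cvg_cst].
  apply: cvgMr; apply: cvgB; last exact: cvg_cst.
  exact: exprn_continuous.
- by rewrite /f sqrrN !subrr mulr0 subr0.
- by rewrite /f PE !subrr mulr0 subr0.
- move=> y ly.
  have {}ly : itvl l y by apply/itvlE; case/andP: ly => /ltW -> ->.
  rewrite -(subrr c).
  have L : (P (y + h j) + P (y - h j) - 2 * P y) / h j ^+ 2 - c @[j --> \oo] --> c - c.
    by apply: cvgB; [exact: quotient_cvg|exact: cvg_cst].
  apply: cvg_trans L; apply: near_eq_cvg; apply: nearW => j /=.
  have hj := h_gt0 j.
  rewrite /f; set p := P (y + h j); set q := P (y - h j); field.
  by rewrite gt_eqF.
Qed.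

(** At the endpoint -l the periodic function P has, if a 0 is not zero, a corner
between two arcs of the parabola: the second differences there are of order
h and not of order h^2. *)
Let mean0 : a 0%N = 0.
Proof.
have p0 := @pi_gt0 R; have lp := l_gt0.
pose c := a 0%N * (pi / l) ^+ 2.
have llE : itvl l (- l) by apply/itvlE; rewrite lexx/=; lra.
have hq : h j * ((P (- l + h j) + P (- l - h j) - 2 * P (- l)) / h j ^+ 2)
    @[j --> \oo] --> (0 : R).
  by rewrite -(mul0r c); apply: cvgM; [exact: h_cvg0|exact: quotient_cvg llE].
have hc : c * h j - 2 * l * c @[j --> \oo] --> c * 0 - 2 * l * c.
  by apply: cvgB; [apply: cvgMr; exact: h_cvg0|exact: cvg_cst].
have E : \forall j \near \oo,
    h j * ((P (- l + h j) + P (- l - h j) - 2 * P (- l)) / h j ^+ 2) =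
    c * h j - 2 * l * c.
  have /cvgrPdist_lt/(_ l l_gt0) := h_cvg0.
  apply: filterS => j; rewrite sub0r normrN gtr0_norm ?h_gt0// => hl.
  have hp := h_gt0 j.
  have -> : P (- l + h j) = P (- l) + c / 2 * ((- l + h j) ^+ 2 - l ^+ 2).
    by apply: P_parabola; apply/andP; split; lra.
  have -> : P (- l - h j) = P (- l) + c / 2 * ((- l - h j + 2 * l) ^+ 2 - l ^+ 2).
    by rewrite -(P_shift (- l - h j)); apply: P_parabola; apply/andP; split; lra.
  have aux (p q r : R) : r != 0 -> r * ((p + q / 2 * ((- l + r) ^+ 2 - l ^+ 2) +
      (p + q / 2 * ((- l - r + 2 * l) ^+ 2 - l ^+ 2)) - 2 * p) / r ^+ 2) =
      q * r - 2 * l * q by move=> r0; field.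
  by apply: aux; rewrite gt_eqF.
have c0 : 0 = c * 0 - 2 * l * c.
  have hq' : c * h j - 2 * l * c @[j --> \oo] --> (0 : R).
    by apply: cvg_trans hq; apply: near_eq_cvg; exact: E.
  exact: cvg_unique hq' hc.
have : c * (2 * l) = 0 by move: c0; lra.
have nz : (pi / l) ^+ 2 * (2 * l) != 0.
  by rewrite gt_eqF// mulr_gt0 ?exprn_gt0 ?divr_gt0 ?mulr_gt0.
by move/eqP; rewrite /c -mulrA mulf_eq0 (negbTE nz) orbF => /eqP.
Qed.

Let P_constant x : itvl l x -> P x = P (- l).
Proof.
move=> /itvlE /andP[h1 h2]; rewrite P_parabola ?h1 ?ltW//.
by rewrite mean0 !mul0r addr0.
Qed.

(** P being constant, its product with a cosine or sine has integral 0. Integrating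
the uniformly convergent series termwise, orthogonality leaves a single term. *)
Let coef0 (w : nat -> R -> R) (c : nat -> R) k : (0 < k)%N ->
  continuous (w k) -> (forall x, `|w k x| <= 1) -> I (w k) = 0 ->
  (forall n, I (fun x => u n x * w k x) = if n == k then l * c k else 0) ->
  c k = 0.
Proof.
move=> k0 wc w1 wI uw; have [C C0 tail] := uniform_tail.
have vw n : continuous (fun x => v n x * w k x).
  by move=> x; apply: cvgM (wc x); apply: cvgMl; exact: trig_continuous.
have sw n : continuous (fun x => series (v ^~ x) n * w k x).
  by move=> x; apply: cvgM (wc x); exact: series_v_continuous.
have sI n : (k < n)%N -> I (fun x => series (v ^~ x) n * w k x) = l * c k / k%:R ^+ 2.
  have sI0 : forall n, I (fun x => series (v ^~ x) n * w k x) =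
      if (k < n)%N then l * c k / k%:R ^+ 2 else 0.
    elim => [|{}n IH].
      rewrite ltn0 (_ : (fun x => _) = (fun=> 0)).
        by rewrite Rintegral_cst ?mul0r//; exact: itvl_measurable.
      by apply/funext => x; rewrite /series/= big_geq// mul0r.
    transitivity (I (fun x => series (v ^~ x) n * w k x +
        (n%:R ^+ 2)^-1 * (u n x * w k x))).
      apply: eq_Rintegral => x _; rewrite /series/= big_nat_recr//= mulrDl.
      by congr (_ + _); rewrite /v; ring.
    have uc : continuous (fun x => u n x * w k x).
      by move=> x; apply: cvgM (wc x); exact: trig_continuous.
    rewrite Rintegral_itvl_add//; last by move=> x; apply: cvgMr; exact: uc.
    rewrite IH Rintegral_itvl_scale// uw [in RHS]ltnS [in RHS]leq_eqVlt (eq_sym k n).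
    case: eqP => [nk|_]; first by rewrite nk ltnn add0r mulrC.
    by rewrite mulr0 addr0.
  by rewrite sI0 => ->.
have bound n : (k < n)%N -> `|l * c k / k%:R ^+ 2| <= C / n.+1%:R * (2 * l).
  move=> kn; rewrite -(sI n kn).
  have -> : I (fun x => series (v ^~ x) n * w k x) =
      I (fun x => series (v ^~ x) n * w k x - P (- l) * w k x).
    rewrite RintegralB; [|exact: itvl_measurable|exact: continuous_itvl_integrable|].
      by rewrite Rintegral_itvl_scale// wI mulr0 subr0.
    by apply: continuous_itvl_integrable => x; apply: cvgMr; exact: wc.
  have ci : continuous (fun x => series (v ^~ x) n * w k x - P (- l) * w k x).
    by move=> x; apply: cvgB; [exact: sw|apply: cvgMr; exact: wc].
  have ml := @itvl_measurable R l.
  rewrite (le_trans (le_normr_Rintegral _ _))//; first exact: continuous_itvl_integrable.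
  have -> : C / n.+1%:R * (2 * l) = I (fun=> C / n.+1%:R).
    by rewrite Rintegral_cst//; congr (_ * _); exact: (esym (congr1 fine (itvl_measure l_gt0))).
  apply: le_Rintegral => //.
  - by apply: continuous_itvl_integrable => x; apply: cvg_norm; exact: ci.
  - by apply: continuous_itvl_integrable; exact: cst_continuous.
  - move=> x lx; rewrite -mulrBl normrM -[leRHS]mulr1 ler_pM//.
    by rewrite distrC -(P_constant lx); exact: (tail x).2.
have lim0 : C / n.+1%:R * (2 * l) @[n --> \oo] --> (0 : R).
  rewrite -(mul0r (2 * l)) -(mulr0 C); apply: cvgMl; apply: cvgMr.
  exact: cvg_harmonic.
have : `|l * c k / k%:R ^+ 2| <= 0.
  rewrite -(cvg_lim _ lim0)//; apply: limr_ge; first by apply/cvg_ex; eexists; exact: lim0.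
  by exists k.+1 => // n /= kn; exact: bound.
rewrite normr_le0 mulf_eq0 invr_eq0 expf_eq0/= pnatr_eq0 -(negbK (k == 0%N)) -lt0n k0 orbF.
by rewrite mulf_eq0 gt_eqF// => /eqP.
Qed.

(** The generalized second derivative of P determines a 0, and P itself the other
coefficients. *)
Theorem cantor_uniqueness : a 0%N = 0 /\ forall k, (0 < k)%N -> a k = 0 /\ b k = 0.
Proof.
split; first exact: mean0.
move=> k k0; split.
- apply: (@coef0 (fun k x => cos (arg k x)) a k) => //.
  + exact: cos_arg_continuous.
  + by move=> x; exact: cos_max.
  + exact: integral_cos.
  + by move=> n; exact: integral_trig_cos.
- apply: (@coef0 (fun k x => sin (arg k x)) b k) => //.
  + exact: sin_arg_continuous.
  + by move=> x; exact: sin_max.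
  + exact: integral_sin.
  + by move=> n; exact: integral_trig_sin.
Qed.

End CantorUniqueness.

(** * Inverting the exponential of the operator *)

Section ExponentialInverse.
Context {R : realType} (l : R).
Hypothesis l_gt0 : 0 < l.
Local Notation "'I' f" := (\int[lebesgue_measure]_(x in itvl l) f x)
  (at level 10, f at level 8).
Local Notation arg k x := (k%:R * pi * x / l).
Local Notation one := (indic_itvl l).
Implicit Types (f g h : bcfun l) (c s : R).

Let l_neq0 : l != 0. Proof. by rewrite gt_eqF. Qed.

Lemma bcfun_ext f g : (forall x, itvl l x -> f x = g x) -> f = g.
Proof.
move=> fg; apply: val_inj; apply/funext => x /=.
by have [/fg//|lx] := pselect (itvl l x); rewrite !bcfun_out.
Qed.

Lemma oneE x : itvl l x -> one x = 1.
Proof. by move=> lx; rewrite /= indicE mem_set. Qed.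

Lemma bcfunDE f g x : (f + g) x = f x + g x.
Proof. by []. Qed.

Lemma bcfunZE c f x : (c *: f) x = c * f x.
Proof. by []. Qed.

Lemma fourier_cos_affine f c k :
  fourier_cos l (f + c *: one) k = fourier_cos l f k + if k == 0%N then 2 * c else 0.
Proof.
rewrite /fourier_cos; have ml := @itvl_measurable R l.
have cc := @cos_arg_continuous R l k.
have c1 x : `|cos (arg k x)| <= 1 by exact: cos_max.
have -> : I (fun x => (f + c *: one) x * cos (arg k x)) =
    I (fun x => f x * cos (arg k x) + c * cos (arg k x)).
  apply: eq_Rintegral => x /set_mem lx.
  by rewrite bcfunDE bcfunZE oneE// mulr1 mulrDl.
have ic := @continuous_itvl_integrable R l _ cc.
rewrite RintegralD//; last 2 first.
- exact: bcfun_mul_integrable.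
- by apply: continuous_itvl_integrable => x; apply: cvgMr; exact: cc.
rewrite Rintegral_itvl_scale// integral_cos0// mulrDr; congr (_ + _).
by case: eqP => _; [field|rewrite !mulr0].
Qed.

Lemma fourier_sin_affine f c k :
  fourier_sin l (f + c *: one) k = fourier_sin l f k.
Proof.
rewrite /fourier_sin; have ml := @itvl_measurable R l.
have cc := @sin_arg_continuous R l k.
have c1 x : `|sin (arg k x)| <= 1 by exact: sin_max.
have -> : I (fun x => (f + c *: one) x * sin (arg k x)) =
    I (fun x => f x * sin (arg k x) + c * sin (arg k x)).
  apply: eq_Rintegral => x /set_mem lx.
  by rewrite bcfunDE bcfunZE oneE// mulr1 mulrDl.
rewrite RintegralD//; last 2 first.
- exact: bcfun_mul_integrable.
- by apply: continuous_itvl_integrable => x; apply: cvgMr; exact: cc.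
by rewrite Rintegral_itvl_scale// integral_sin// mulr0 addr0.
Qed.

Definition fourier_a (f : R -> R) k : R :=
  if k is 0%N then fourier_cos l f 0%N / 2 else fourier_cos l f k.

Lemma fourier_termE (f : R -> R) k x :
  fourier_term l f k x = trig l (fourier_a f) (fourier_sin l f) k x.
Proof. by case: k => [|k]//=; rewrite trig0. Qed.

Lemma fourier_a_affine f c k :
  fourier_a (f + c *: one) k = fourier_a f k + if k == 0%N then c else 0.
Proof.
by case: k => [|k]; rewrite /fourier_a fourier_cos_affine//=; field.
Qed.

Lemma series_add_first (u v : nat -> R) (c L : R) :
  (forall k, v k = u k + if k == 0%N then c else 0) ->
  series u @ \oo --> L -> series v @ \oo --> L + c.
Proof.
move=> vE uL.
have L' : series u n + c @[n --> \oo] --> L + c by apply: cvgD; [exact: uL|exact: cvg_cst].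
apply: cvg_trans L'; apply: near_eq_cvg; near=> n.
have n0 : (0 < n)%N by near: n; exists 1%N.
rewrite /series/= (eq_bigr _ (fun k _ => vE k)) big_split/=; congr (_ + _).
rewrite big_ltn//= big_nat big1 ?addr0// => k /andP[k0 _].
by rewrite gtn_eqF.
Unshelve. all: by end_near. Qed.

Lemma FD0_affine f c : FD0 f -> FD0 (f + c *: one).
Proof.
move=> f0 x lx; rewrite bcfunDE bcfunZE oneE// mulr1.
apply: series_add_first (f0 x lx) => k.
rewrite !fourier_termE /trig fourier_a_affine fourier_sin_affine mulrDl addrAC.
by congr (_ + _ + _); case: eqP => [->|_]; rewrite ?mul0r// cos0 mulr1.
Qed.

(** The difference between the Fourier series of f and the given series converges
to 0 everywhere, so [cantor_uniqueness] applies. *)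
Lemma fourier_coefficients_unique f (p q : nat -> R) : FD0 f ->
  (forall x, itvl l x -> series (fun k => trig l p q k x) @ \oo --> f x) ->
  (forall k, fourier_a f k = p k) /\
  (forall k, (0 < k)%N -> fourier_sin l f k = q k).
Proof.
move=> f0 pq.
have [a0 ab] : (fun k => fourier_a f k - p k) 0%N = 0 /\ forall k, (0 < k)%N ->
    (fun k => fourier_a f k - p k) k = 0 /\
    (fun k => fourier_sin l f k - q k) k = 0.
  apply: (@cantor_uniqueness R l l_gt0) => x lx.
  have : series (fun k => fourier_term l f k x) n - series (fun k => trig l p q k x) n
    @[n --> \oo] --> f x - f x.
    by apply: cvgB; [exact: f0|exact: pq].
  rewrite subrr; apply: cvg_trans; apply: near_eq_cvg; apply: nearW => n.
  rewrite /series/= -sumrB; apply: eq_bigr => k _.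
  by rewrite fourier_termE /trig; ring.
split=> [k|k k0]; last by apply/eqP; rewrite -subr_eq0; apply/eqP; exact: (ab k k0).2.
apply/eqP; rewrite -subr_eq0; apply/eqP.
by case: (posnP k) => [->//|/ab[]].
Qed.

Section Semigroup.
Variables (m : nat) (A : nat -> R).
Local Notation sg := (sigma_ l m A).
Local Notation om := (omega_ l m A).

Definition expA_a s (f : R -> R) k : R :=
  if k is 0%N then expR (s * A 0%N) * fourier_cos l f 0%N / 2
  else expR (sg k * s) *
    (fourier_cos l f k * cos (om k * s) + fourier_sin l f k * sin (om k * s)).

Definition expA_b s (f : R -> R) k : R := expR (sg k * s) *
  (fourier_sin l f k * cos (om k * s) - fourier_cos l f k * sin (om k * s)).

Lemma expA_termE s (f : R -> R) k x :
  expA_term l m A s f k x = trig l (expA_a s f) (expA_b s f) k x.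
Proof. by case: k => [|k]; rewrite ?trig0// /expA_term/= /trig/= /expA_b; ring. Qed.

Lemma is_expA_unique s f g h : is_expA m A s f g -> is_expA m A s f h -> g = h.
Proof.
move=> [_ fg] [_ fh]; apply: bcfun_ext => x lx.
exact: cvg_unique (fg x lx) (fh x lx).
Qed.

Lemma is_expA_expA s f g : is_expA m A s f g -> expA m A s f = g.
Proof.
move=> fg; rewrite /expA; apply: xget_unique => // h fh.
exact: is_expA_unique fh fg.
Qed.

(** The constant function only has a zeroth Fourier coefficient, on which the
operator acts by the factor e^(s A_0). *)
Lemma is_expA_affine s f g c : is_expA m A s f g ->
  is_expA m A s (f + c *: one) (g + (expR (s * A 0%N) * c) *: one).
Proof.
move=> [f0 fg]; split; first exact: FD0_affine.
move=> x lx; rewrite bcfunDE bcfunZE oneE// mulr1.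
apply: series_add_first (fg x lx) => k.
have hc := fourier_cos_affine f c; have hs := fourier_sin_affine f c.
rewrite /expA_term.
move: (fourier_cos l (f + c *: one)) (fourier_sin l (f + c *: one)) hc hs => C S hC hS.
by case: k => [|k] /=; rewrite !hC ?hS /= ?addr0//; field.
Qed.

Lemma is_expA_one s : is_expA m A s one (expR (s * A 0%N) *: one).
Proof.
have z0 k : fourier_cos l (0 : bcfun l) k = 0.
  rewrite /fourier_cos (_ : (fun x => _) = (fun=> 0)) ?Rintegral_cst ?mul0r ?mulr0//.
    exact: itvl_measurable.
  by apply/funext => x; rewrite mul0r.
have z1 k : fourier_sin l (0 : bcfun l) k = 0.
  rewrite /fourier_sin (_ : (fun x => _) = (fun=> 0)) ?Rintegral_cst ?mul0r ?mulr0//.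
    exact: itvl_measurable.
  by apply/funext => x; rewrite mul0r.
have : is_expA m A s (0 : bcfun l) 0.
  split=> x lx.
    rewrite (_ : (fun k => _) = (fun=> 0)); last first.
      by apply/funext => -[|k] /=; rewrite !z0 ?z1 !mul0r ?addr0.
    rewrite (_ : series _ = (fun=> 0)); first exact: cvg_cst.
    by apply/funext => n; rewrite /series/= big1.
  rewrite (_ : (fun k => _) = (fun=> 0)); last first.
    apply/funext => -[|k] /=; rewrite /expA_term !z0 ?z1 ?mulr0 !mul0r//.
    by rewrite addr0 subr0 !mul0r addr0 mulr0.
  rewrite (_ : series _ = (fun=> 0)); first exact: cvg_cst.
  by apply/funext => n; rewrite /series/= big1.
by move/(is_expA_affine 1); rewrite !add0r mulr1 scale1r.
Qed.

(** The operator rescales and rotates each pair of coefficients, and its value at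
- s does the inverse. As g is the sum of its Fourier series, the rescaled and
rotated coefficients are indeed the Fourier coefficients of g. *)
Lemma is_expA_inverse s f g : is_expA m A s f g -> FD0 g -> is_expA m A (- s) g f.
Proof.
move=> [f0 fg] g0; split => // x lx.
have fg' y : itvl l y -> series (fun k => trig l (expA_a s f) (expA_b s f) k y) @ \oo --> g y.
  move=> ly; rewrite (_ : (fun k => _) = (fun k => expA_term l m A s f k y)).
    exact: fg.
  by apply/funext => k; rewrite expA_termE.
have [ga gb] := fourier_coefficients_unique g0 fg'.
rewrite (_ : (fun k => _) = (fun k => fourier_term l f k x)); first exact: f0.
apply/funext => -[|k].
  have ga0 : fourier_cos l g 0 / 2 = expR (s * A 0%N) * fourier_cos l f 0 / 2.
    exact: (ga 0%N).
  by rewrite /expA_term/= -mulrA ga0 !mulrA -expRD mulNr addNr expR0 mul1r.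
have ga' : fourier_cos l g k.+1 = expA_a s f k.+1 by exact: (ga k.+1).
have gb' : fourier_sin l g k.+1 = expA_b s f k.+1 by exact: gb.
rewrite /expA_term /fourier_term ga' gb' /expA_a /expA_b !mulrN cosN sinN.
have E : expR (- (sg k.+1 * s)) * expR (sg k.+1 * s) = 1.
  by rewrite -expRD addNr expR0.
have CS := cos2Dsin2 (om k.+1 * s).
move: (expR (- (sg k.+1 * s))) (expR (sg k.+1 * s)) (cos (om k.+1 * s))
  (sin (om k.+1 * s)) E CS => e1 e2 C S E CS.
move: (fourier_cos l f k.+1) (fourier_sin l f k.+1) => c d.
move: (cos (arg k.+1 x)) (sin (arg k.+1 x)) => X Y.
transitivity (e1 * e2 * (C ^+ 2 + S ^+ 2) * (c * X + d * Y)); first by ring.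
by rewrite E CS !mul1r.
Qed.


Lemma is_expA_inverse_affine s f g c : is_expA m A s f g -> FD0 g ->
  is_expA m A (- s) (g + c *: one) (f + (expR (- s * A 0%N) * c) *: one).
Proof. by move=> fg g0; apply: is_expA_affine; exact: is_expA_inverse. Qed.

End Semigroup.

End ExponentialInverse.

(** * Square integrable random variables *)

Section SquareIntegrable.
Context d (T : measurableType d) (R : realType) (P : probability T R).
Local Notation "'mean' f" := (\int[P]_w f w) (at level 10, f at level 8).
Implicit Types (X Y : T -> R) (c : R).

Definition sq_int X : Prop := measurable_fun setT X /\
  P.-integrable setT (EFin \o (fun w => X w ^+ 2)).

Lemma sq_int_prod X Y : sq_int X -> sq_int Y ->
  P.-integrable setT (EFin \o (fun w => X w * Y w)).
Proof.
move=> [mX iX] [mY iY].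
apply: le_integrable (integrableD _ iX iY) => //.
  by apply/measurable_EFinP; exact: measurable_funM.
move=> w _ /=; rewrite lee_fin [leRHS]ger0_norm ?addr_ge0 ?sqr_ge0//.
rewrite ler_norml; have := sqr_ge0 (X w + Y w); have := sqr_ge0 (X w - Y w).
have := sqr_ge0 (X w); have := sqr_ge0 (Y w).
by move: (X w) (Y w) => x y; nra.
Qed.

Lemma sq_int_cst c : sq_int (cst c).
Proof.
split; first exact: measurable_cst.
by apply: (@finite_measure_integrable_cst _ _ _ P setT (c ^+ 2)).
Qed.

Lemma sq_int_integrable X : sq_int X -> P.-integrable setT (EFin \o X).
Proof.
move=> /(sq_int_prod (sq_int_cst 1)); apply: eq_integrable => // w _.
by rewrite /= mul1r.
Qed.

Lemma sq_intD X Y : sq_int X -> sq_int Y -> sq_int (fun w => X w + Y w).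
Proof.
move=> sX sY; have [mX iX] := sX; have [mY iY] := sY.
split; first exact: measurable_funD.
apply: eq_integrable (integrableD _ (integrableD _ iX iY)
  (integrableZl _ 2 (sq_int_prod sX sY))) => // w _ /=.
by rewrite -EFinM -!EFinD; congr EFin; ring.
Qed.

Lemma sq_intZ c X : sq_int X -> sq_int (fun w => c * X w).
Proof.
move=> sX; have [mX iX] := sX.
split; first by apply: measurable_funM.
apply: eq_integrable (integrableZl _ (c ^+ 2) iX) => // w _ /=.
by rewrite -EFinM exprMn.
Qed.

Lemma sq_intB X Y : sq_int X -> sq_int Y -> sq_int (fun w => X w - Y w).
Proof.
move=> sX sY; rewrite (_ : (fun w => _) = (fun w => X w + -1 * Y w)).
  by apply: sq_intD => //; exact: sq_intZ.
by apply/funext => w; rewrite mulN1r.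
Qed.

Lemma sq_int_sum (Y : nat -> T -> R) m n : (forall i, sq_int (Y i)) ->
  sq_int (fun w => \sum_(m <= i < n) Y i w).
Proof.
move=> sY; elim: n => [|n IH].
  rewrite (_ : (fun w => _) = cst 0); first exact: sq_int_cst.
  by apply/funext => w; rewrite big_geq.
have [mn|nm] := leqP m n.
  rewrite (_ : (fun w => _) = (fun w => \sum_(m <= i < n) Y i w + Y n w)).
    exact: sq_intD.
  by apply/funext => w; rewrite big_nat_recr.
rewrite (_ : (fun w => _) = cst 0); first exact: sq_int_cst.
by apply/funext => w; rewrite big_geq.
Qed.

Lemma meanD X Y : P.-integrable setT (EFin \o X) -> P.-integrable setT (EFin \o Y) ->
  mean (fun w => X w + Y w) = mean X + mean Y.
Proof. exact: RintegralD. Qed.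

Lemma meanZ c X : P.-integrable setT (EFin \o X) -> mean (fun w => c * X w) = c * mean X.
Proof. exact: RintegralZl. Qed.

Lemma mean_cst c : mean (cst c) = c.
Proof.
rewrite Rintegral_cst//= (_ : fine _ = 1) ?mulr1//.
by rewrite -[RHS]/(fine 1%:E) -(probability_setT P).
Qed.

Lemma mean_sqr_ge0 X : 0 <= mean (fun w => X w ^+ 2).
Proof. by apply: Rintegral_ge0 => w _; exact: sqr_ge0. Qed.

Lemma integral_sqrE X : sq_int X ->
  (\int[P]_w (X w ^+ 2)%:E)%E = (mean (fun w => X w ^+ 2))%:E.
Proof. by move=> [mX iX]; rewrite fineK//; exact: integrable_fin_num. Qed.

Lemma mean_sqrD X Y : sq_int X -> sq_int Y ->
  mean (fun w => (X w + Y w) ^+ 2) =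
  mean (fun w => X w ^+ 2) + 2 * mean (fun w => X w * Y w) + mean (fun w => Y w ^+ 2).
Proof.
move=> sX sY; have [mX iX] := sX; have [mY iY] := sY.
have iXY := sq_int_prod sX sY.
have i2 : P.-integrable setT (EFin \o (fun w => 2 * (X w * Y w))).
  exact: (integrableZl measurableT 2 iXY).
rewrite -(meanZ 2 iXY) -meanD// -meanD//; last exact: (integrableD measurableT iX i2).
by apply: eq_Rintegral => w _; ring.
Qed.

(** The variance is nonnegative. *)
Lemma sqr_mean_le X : sq_int X -> (mean X) ^+ 2 <= mean (fun w => X w ^+ 2).
Proof.
move=> sX; have := mean_sqr_ge0 (fun w => X w + cst (- mean X) w).
rewrite mean_sqrD//; last exact: sq_int_cst.
have -> : mean (fun w => X w * cst (- mean X) w) = - mean X * mean X.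
  rewrite -(meanZ _ (sq_int_integrable sX)).
  by apply: eq_Rintegral => w _; rewrite mulrC.
have -> : mean (fun w => cst (- mean X) w ^+ 2) = (- mean X) ^+ 2 := mean_cst ((- mean X) ^+ 2).
by move: (mean X) (mean (fun w => X w ^+ 2)) => e v; nra.
Qed.

Lemma mean_sum (Y : nat -> T -> R) m n :
  (forall i, P.-integrable setT (EFin \o Y i)) ->
  P.-integrable setT (EFin \o (fun w => \sum_(m <= i < n) Y i w)) /\
  mean (fun w => \sum_(m <= i < n) Y i w) = \sum_(m <= i < n) mean (Y i).
Proof.
move=> iY.
have zero k : (k <= m)%N -> P.-integrable setT (EFin \o (fun w => \sum_(m <= i < k) Y i w)) /\
    mean (fun w => \sum_(m <= i < k) Y i w) = \sum_(m <= i < k) mean (Y i).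
  move=> km; rewrite big_geq// (_ : (fun w => _) = cst 0).
    by rewrite mean_cst; split=> //; exact: sq_int_integrable (sq_int_cst 0).
  by apply/funext => w; rewrite big_geq.
elim: n => [|n [iS ES]]; first exact: zero.
have [mn|] := leqP m n; last exact: zero.
rewrite (_ : (fun w => _) = (fun w => \sum_(m <= i < n) Y i w + Y n w)); last first.
  by apply/funext => w; rewrite big_nat_recr.
rewrite meanD// ES big_nat_recr//; split=> //.
exact: (integrableD measurableT iS (iY n)).
Qed.

(** The theorem of Pythagoras. *)
Lemma orthogonal_sum (Y : nat -> T -> R) m n : (forall i, sq_int (Y i)) ->
  (forall i j, (i < j)%N -> mean (fun w => Y i w * Y j w) = 0) ->
  mean (fun w => (\sum_(m <= i < n) Y i w) ^+ 2) =
  \sum_(m <= i < n) mean (fun w => Y i w ^+ 2).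
Proof.
move=> sY oY.
have zero k : (k <= m)%N -> mean (fun w => (\sum_(m <= i < k) Y i w) ^+ 2) =
    \sum_(m <= i < k) mean (fun w => Y i w ^+ 2).
  move=> km; rewrite [RHS]big_geq// (_ : (fun w => _) = cst 0) ?mean_cst//.
  by apply/funext => w; rewrite big_geq// expr0n.
elim: n => [|n IH]; first exact: zero.
have [mn|] := leqP m n; last exact: zero.
rewrite (_ : (fun w => _) = (fun w => (\sum_(m <= i < n) Y i w + Y n w) ^+ 2)); last first.
  by apply/funext => w; rewrite big_nat_recr.
rewrite mean_sqrD//; last exact: sq_int_sum.
rewrite IH big_nat_recr//= (_ : mean (fun w => _ * _) = 0) ?mulr0 ?addr0//.
under eq_Rintegral do rewrite big_distrl/=.
have [_ ->] := @mean_sum (fun i w => Y i w * Y n w) m n (fun i => sq_int_prod (sY i) (sY n)).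
by rewrite big_nat_cond big1// => i /andP[/andP[_ ni] _]; exact: oY.
Qed.

End SquareIntegrable.

Section Independence.
Context d (T : measurableType d) (R : realType) (P : probability T R).

(** The joint law of independent variables is the product of their laws, so that
Fubini gives E(XY) = E(X) E(Y). *)
Lemma independent_orthogonal (X Y : T -> R) :
  sq_int P X -> sq_int P Y ->
  (forall B C, measurable B -> measurable C ->
    P (X @^-1` B `&` Y @^-1` C) = (P (X @^-1` B) * P (Y @^-1` C))%E) ->
  \int[P]_w X w = 0 -> \int[P]_w (X w * Y w) = 0.
Proof.
move=> sX sY ind X0.
have [mX _] := sX; have [mY _] := sY.
have iX := sq_int_integrable sX; have iY := sq_int_integrable sY.
have iXY := sq_int_prod sX sY.
pose fX : {mfun T >-> R} := HB.pack X (isMeasurableFun.Build _ _ _ _ _ mX).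
pose fY : {mfun T >-> R} := HB.pack Y (isMeasurableFun.Build _ _ _ _ _ mY).
have mXY : measurable_fun setT (fun w => (X w, Y w)) by exact: measurable_fun_pair.
pose fXY : {mfun T >-> (R * R)%type} :=
  HB.pack (fun w => (X w, Y w)) (isMeasurableFun.Build _ _ _ _ _ mXY).
pose m1 : probability _ R := distribution P fX.
pose m2 : probability _ R := distribution P fY.
pose m : probability _ R := distribution P fXY.
have mE A : measurable A -> (m1 \x m2)%E A = m A.
  by apply: product_measure_unique => B C mB mC; exact: ind.
pose f (z : R * R) : \bar R := (z.1 * z.2)%:E.
have mf : measurable_fun setT f.
  by apply/measurable_EFinP; apply: measurable_funM.
have if_m : m.-integrable setT f.
  by apply: integrable_pushforward => //; exact: iXY.
have if_p : (m1 \x m2)%E.-integrable setT f.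
  apply/integrableP; split => //; have /integrableP[_] := if_m.
  rewrite (@eq_measure_integral _ _ _ setT m (m1 \x m2)%E)// => A mA _.
  exact: mE.
rewrite /Rintegral.
have -> : (\int[P]_w (X w * Y w)%:E = \int[m]_z f z)%E.
  by rewrite [RHS]integral_pushforward//; exact: iXY.
rewrite (@eq_measure_integral _ _ _ setT (m1 \x m2)%E m); last first.
  by move=> A mA _; exact: esym (mE _ mA).
rewrite -(@integral12_prod_meas1 _ _ _ _ _ m1 m2 f if_p) /f/=.
have iY2 : m2.-integrable setT (EFin \o id).
  by apply: integrable_pushforward => //; apply/measurable_EFinP.
have iX1 : m1.-integrable setT (EFin \o id).
  by apply: integrable_pushforward => //; apply/measurable_EFinP.
have EY : (\int[m2]_y y%:E)%E \is a fin_num by exact: integrable_fin_num iY2.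
transitivity (fine (\int[m1]_x (x%:E * (fine (\int[m2]_y y%:E))%:E))%E).
  congr fine; apply: eq_integral => x _.
  by rewrite fineK// -integralZl.
rewrite integralZr//.
have -> : (\int[m1]_x x%:E = \int[P]_w (X w)%:E)%E by rewrite [LHS]integral_pushforward.
rewrite -(fineK (integrable_fin_num _ iX))//.
by move: X0; rewrite /Rintegral => ->; rewrite mul0e.
Qed.

End Independence.

(** * The law of large numbers for orthogonal variables *)

Section LawOfLargeNumbers.
Context d (T : measurableType d) (R : realType) (P : probability T R).
Local Notation "'mean' f" := (\int[P]_w f w) (at level 10, f at level 8).

Lemma square_bracket k : (0 < k)%N -> exists n, (n.+1 ^ 2 <= k < n.+2 ^ 2)%N.
Proof.
elim: k => // k IH _; case: (posnP k) => [->|/IH[n /andP[nk kn]]].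
  by exists 0%N.
have [kn'|kn'] := ltnP k.+1 (n.+2 ^ 2).
  by exists n; rewrite (leq_trans nk).
exists n.+1; rewrite kn'/= (leq_trans (n := (n.+2 ^ 2).+1))//.
by rewrite ltn_exp2r.
Qed.

Lemma sum_inv_sqr_le n : \sum_(0 <= i < n) (i.+1%:R ^+ 2)^-1 <= 2 :> R.
Proof.
suff : \sum_(0 <= i < n) (i.+1%:R ^+ 2)^-1 <= 2 - 2 / n.+1%:R :> R.
  by move/le_trans; apply; rewrite gerBl divr_ge0.
elim: n => [|n IH]; first by rewrite big_geq// divr1 subrr.
rewrite big_nat_recr//= (le_trans (lerD IH (lexx _)))//.
have n1 : 0 < n.+1%:R :> R by [].
have n1' : 1 <= n.+1%:R :> R by rewrite ler1n.
rewrite -[n.+2%:R]natr1; set x := n.+1%:R in n1 n1' *.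
rewrite -subr_ge0 [leRHS](_ : _ = (x - 1) / (x ^+ 2 * (x + 1))).
  by rewrite divr_ge0 ?subr_ge0// mulr_ge0 ?sqr_ge0// addr_ge0 ?ltW.
by field; rewrite gt_eqF//=; lra.
Qed.

(** The integrals of the f n are summable, so the sum of the f n has a finite
integral. It is then finite almost everywhere, and its terms tend to 0. *)
Lemma ae_cvg0_summable (f : nat -> T -> R) (C : R) :
  (forall n, measurable_fun setT (f n)) -> (forall n w, 0 <= f n w) ->
  (forall n, (\int[P]_w (f n w)%:E <= (C * (n.+1%:R ^+ 2)^-1)%:E)%E) ->
  {ae P, forall w, f n w @[n --> \oo] --> (0 : R)}.
Proof.
move=> mf f0 fC.
pose G w := (\sum_(0 <= n <oo) (f n w)%:E)%E.
have mfE n : measurable_fun setT (fun w => (f n w)%:E) by exact/measurable_EFinP.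
have G0 w : (0 <= G w)%E by apply: nneseries_ge0 => n _ _; rewrite lee_fin.
have C0 : 0 <= C.
  have h : (0 <= \int[P]_w (f 0%N w)%:E)%E.
    by apply: integral_ge0 => w _; rewrite lee_fin.
  by have := le_trans h (fC 0%N); rewrite lee_fin expr1n invr1 mulr1.
have mG : measurable_fun setT G.
  by apply: ge0_emeasurable_sum => // k w _ _; rewrite lee_fin.
have iG : (\int[P]_w G w < +oo)%E.
  rewrite integral_nneseries//; last by move=> n w _; rewrite lee_fin.
  apply: (@le_lt_trans _ _ (C * 2)%:E); last exact: ltry.
  apply: lime_le.
    by apply: is_cvg_nneseries => n _ _; apply: integral_ge0 => w _; rewrite lee_fin.
  apply: nearW => n; apply: (@le_trans _ _ (\sum_(0 <= i < n) (C * (i.+1%:R ^+ 2)^-1)%:E)%E).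
    by apply: lee_sum => i _; exact: fC.
  by rewrite sumEFin lee_fin -mulr_sumr ler_wpM2l// sum_inv_sqr_le.
have : P.-integrable setT G.
  by apply/integrableP; split=> //; under eq_integral do rewrite gee0_abs//.
move/(integrable_ae measurableT); apply: filterS => w /(_ I) Gw.
suff : cvgn (series (f ^~ w)) by exact: cvg_series_cvg_0.
apply: nondecreasing_is_cvgn.
  by apply/nondecreasing_seqP => n; rewrite /series/= big_nat_recr//= lerDl.
exists (fine (G w)) => _ [n _ <-]; rewrite -lee_fin fineK// /series/= -sumEFin.
by apply: nneseries_lim_ge => i _ _; rewrite lee_fin.
Qed.

Section Orthogonal.
Variables (Y : nat -> T -> R) (v : R).
Hypothesis sY : forall i, sq_int P (Y i).
Hypothesis oY : forall i j, (i < j)%N -> mean (fun w => Y i w * Y j w) = 0.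
Hypothesis vY : forall i, mean (fun w => Y i w ^+ 2) <= v.

Let S m n w := \sum_(m <= i < n) Y i w.

Let sS m n : sq_int P (S m n). Proof. exact: sq_int_sum. Qed.

Let S_var m n : mean (fun w => S m n w ^+ 2) <= (n - m)%:R * v.
Proof.
rewrite /S orthogonal_sum// (le_trans (ler_sum _ (fun i _ => vY i)))//.
by rewrite sumr_const_nat mulr_natl.
Qed.

Let v0 : 0 <= v. Proof. exact: le_trans (mean_sqr_ge0 P (Y 0%N)) (vY 0%N). Qed.

Let q n : R := n.+1%:R ^+ 2.

Let q_gt0 n : 0 < q n. Proof. by rewrite exprn_gt0. Qed.

(** Controls, between two consecutive squares, the squares of all the means. Its
integral is of order 1 / n^2: there are of order n indices k, for each of which
the increment from the square to k has variance of order n, and the normalization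
is by n^4. *)
Let F n w : R := (q n)^-1 ^+ 2 * (S 0 (n.+1 ^ 2) w ^+ 2 +
  \sum_(n.+1 ^ 2 <= k < n.+2 ^ 2) S (n.+1 ^ 2) k w ^+ 2).

Let F_ge0 n w : 0 <= F n w.
Proof.
by rewrite mulr_ge0 ?sqr_ge0// addr_ge0 ?sqr_ge0// sumr_ge0// => k _; rewrite sqr_ge0.
Qed.

Let F_integral n : measurable_fun setT (F n) /\
  (\int[P]_w (F n w)%:E <= (10 * v * (n.+1%:R ^+ 2)^-1)%:E)%E.
Proof.
pose g k w := S (n.+1 ^ 2) k w ^+ 2.
have sq_le : (n.+2 ^ 2 <= n.+1 ^ 2 + 3 * n.+1)%N by rewrite !expnS !expn0 !muln1; nia.
have ig k : P.-integrable setT (EFin \o g k) by have [] := sS (n.+1 ^ 2) k.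
have [isum Esum] := mean_sum (n.+1 ^ 2) (n.+2 ^ 2) ig.
have i0 : P.-integrable setT (EFin \o (fun w => S 0 (n.+1 ^ 2) w ^+ 2)).
  by have [] := sS 0 (n.+1 ^ 2).
have i1 := integrableD measurableT i0 isum.
have i2 : P.-integrable setT (EFin \o F n) := integrableZl measurableT ((q n)^-1 ^+ 2) i1.
split; first by apply/measurable_EFinP; exact: measurable_int i2.
rewrite -[leLHS]fineK; last exact: integrable_fin_num i2.
rewrite lee_fin -/(Rintegral P setT (F n)) /F (meanZ _ i1) (meanD i0 isum) Esum.
have h1 : mean (fun w => S 0 (n.+1 ^ 2) w ^+ 2) <= q n * v.
  by rewrite (le_trans (S_var _ _))// subn0 natrX.
have h2 : \sum_(n.+1 ^ 2 <= k < n.+2 ^ 2) mean (g k) <= 9 * q n * v.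
  rewrite (@le_trans _ _ (\sum_(n.+1 ^ 2 <= k < n.+2 ^ 2) (3 * n.+1%:R) * v))//.
    apply: ler_sum_nat => k /andP[_ kn]; rewrite (le_trans (S_var _ _))// ler_wpM2r//.
    by rewrite -natrM ler_nat leq_subLR ltnW// (leq_trans kn).
  rewrite sumr_const_nat -[leLHS]mulr_natl mulrA ler_wpM2r//.
  have -> : 9 * q n = (3 * n.+1)%:R * (3 * n.+1%:R) by rewrite /q natrM; ring.
  by rewrite ler_wpM2r ?mulr_ge0// ler_nat leq_subLR.
rewrite (le_trans (ler_wpM2l _ (lerD h1 h2))) ?sqr_ge0//.
rewrite -mulrDl -[X in X + _]mul1r -mulrDl (_ : 1 + 9 = 10); last by ring.
rewrite -/(q n) le_eqVlt; apply/orP; left; apply/eqP; field.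
by rewrite gt_eqF.
Qed.

(** Along the squares the variances of the means are summable, and between two
consecutive squares the partial sums do not move enough to matter. *)
Theorem orthogonal_law_of_large_numbers :
  {ae P, forall w, n%:R^-1 * \sum_(k < n) Y k w @[n --> \oo] --> (0 : R)}.
Proof.
have := ae_cvg0_summable (fun n => (F_integral n).1) F_ge0 (fun n => (F_integral n).2).
apply: filterS => w Fw; apply/cvgrPdist_le => e e0.
have e2 : 0 < (e / 2) ^+ 2 by rewrite exprn_gt0// divr_gt0.
have /cvgrPdist_le/(_ _ e2)[N _ FN] := Fw.
exists (N.+1 ^ 2)%N => // k /= Nk.
have k0 : (0 < k)%N by rewrite (leq_trans _ Nk)// expn_gt0.
have [n /andP[nk kn]] := square_bracket k0.
have Nn : (N <= n)%N.
  by move: (leq_ltn_trans Nk kn); rewrite ltn_exp2r.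
have := FN n Nn; rewrite /= !sub0r !normrN ger0_norm// => Fe.
have small x : x ^+ 2 <= S 0 (n.+1 ^ 2) w ^+ 2 +
    \sum_(n.+1 ^ 2 <= k < n.+2 ^ 2) S (n.+1 ^ 2) k w ^+ 2 -> `|x| <= e / 2 * q n.
  have [qn e0'] := (ltW (q_gt0 n), ltW e0).
  move=> xF; rewrite -(@ler_pXn2r _ 2)// ?nnegrE ?mulr_ge0 ?divr_ge0//.
  rewrite -normrX ger0_norm ?sqr_ge0// (le_trans xF)// exprMn -ler_pdivrMr ?exprn_gt0//.
  by rewrite mulrC -exprVn.
have kR : 0 < k%:R :> R by rewrite ltr0n.
rewrite normrM normfV normr_nat mulrC ler_pdivrMr//.
have -> : \sum_(i < k) Y i w = S 0 (n.+1 ^ 2) w + S (n.+1 ^ 2) k w.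
  by rewrite -(big_mkord xpredT (fun i => Y i w)) (big_cat_nat (n := (n.+1 ^ 2)%N)).
rewrite (le_trans (ler_normD _ _))// (@le_trans _ _ (e * q n))//.
  rewrite [leRHS](_ : _ = e / 2 * q n + e / 2 * q n); last by field.
  apply: lerD; apply: small.
  - by rewrite lerDl sumr_ge0// => i _; exact: sqr_ge0.
  - rewrite (big_cat_nat (n := k)) ?(ltnW kn)//= [X in _ + (_ + X)]big_ltn//.
    rewrite addrCA [leRHS]addrA addrCA lerDl.
    rewrite !addr_ge0 ?sqr_ge0// sumr_ge0// => i _; exact: sqr_ge0.
by rewrite ler_wpM2l ?(ltW e0)// /q -natrX ler_nat.
Qed.

End Orthogonal.

End LawOfLargeNumbers.

(** * Mean square limits and moments of the normal law *)

Section LowerIntegral.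
Local Open Scope ereal_scope.
Context d (T : measurableType d) (R : realType) (mu : {measure set T -> \bar R}).

(** Holds without measurability, since the integral of a nonnegative function is
the supremum of the integrals of the simple functions below it. *)
Lemma le_lower_integral (D : set T) (f g : T -> \bar R) :
  (forall x, D x -> 0 <= f x) -> (forall x, D x -> f x <= g x) ->
  \int[mu]_(x in D) f x <= \int[mu]_(x in D) g x.
Proof.
move=> f0 fg; have g0 x : D x -> 0 <= g x.
  by move=> Dx; exact: le_trans (f0 x Dx) (fg x Dx).
rewrite !ge0_integralE//; apply: ge_ereal_sup => _ [h hf <-].
apply: ereal_sup_ubound; exists h => // x; apply: le_trans (hf x) _.
exact: lee_restrict.
Qed.

End LowerIntegral.

Section MeanSquareLimit.
Context d (T : measurableType d) (R : realType) (P : probability T R).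
Local Notation "'mean' f" := (\int[P]_w f w) (at level 10, f at level 8).
Variables (X : nat -> T -> R) (G : T -> R).
Hypothesis sX : forall n, sq_int P (X n).
Hypothesis mG : measurable_fun setT G.
Hypothesis XG : (\int[P]_w ((X n w - G w) ^+ 2)%:E)%E @[n --> \oo] --> 0%E.

Lemma mean_square_limit_sq_int : sq_int P G.
Proof.
have /fine_cvgP[[n _ /(_ n (leqnn n)) fin] _] := XG.
have mXn : measurable_fun setT (X n) by case: (sX n).
have sD : sq_int P (fun w => X n w - G w).
  split; first exact: measurable_funB.
  apply/integrableP; split.
    by apply/measurable_EFinP; apply: measurable_funX; exact: measurable_funB.
  under eq_integral do rewrite /= ger0_norm ?sqr_ge0//.
  by rewrite -ge0_fin_numE// integral_ge0// => w _; rewrite lee_fin sqr_ge0.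
rewrite (_ : G = (fun w => X n w - (X n w - G w))); first exact: sq_intB.
by apply/funext => w; ring.
Qed.

Let sG := mean_square_limit_sq_int.

Let dist_cvg0 : mean (fun w => (X n w - G w) ^+ 2) @[n --> \oo] --> (0 : R).
Proof. by have := XG => /fine_cvg. Qed.

Lemma mean_square_limit_mean0 : (forall n, mean (X n) = 0) -> mean G = 0.
Proof.
move=> X0.
have bound n : mean G ^+ 2 <= mean (fun w => (X n w - G w) ^+ 2).
  have := sqr_mean_le (sq_intB (sX n) sG).
  rewrite RintegralB//; [|exact: sq_int_integrable..].
  by rewrite X0 sub0r sqrrN.
have : mean G ^+ 2 <= 0.
  rewrite -(cvg_lim _ dist_cvg0)//; apply: limr_ge.
    by apply/cvg_ex; eexists; exact: dist_cvg0.
  by apply: nearW => n; exact: bound.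
by move=> h; apply/eqP; rewrite -sqrf_eq0 eq_le h sqr_ge0.
Qed.

Lemma mean_square_limit_ae0 :
  mean (fun w => X n w ^+ 2) @[n --> \oo] --> (0 : R) -> {ae P, forall w, G w = 0}.
Proof.
move=> X0.
have bound n : mean (fun w => G w ^+ 2) <=
    2 * mean (fun w => X n w ^+ 2) + 2 * mean (fun w => (X n w - G w) ^+ 2).
  have [_ i1] := sX n; have [_ i2] := sq_intB (sX n) sG; have [_ iG] := sG.
  rewrite -(meanZ 2 i1) -(meanZ 2 i2) -meanD; [|exact: (integrableZl measurableT 2 i1)
                                      |exact: (integrableZl measurableT 2 i2)].
  apply: le_Rintegral => //.
    exact: (integrableD measurableT (integrableZl measurableT 2 i1)
                                    (integrableZl measurableT 2 i2)).
  move=> w _; have := sqr_ge0 (2 * X n w - G w).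
  by move: (X n w) (G w) => x g; nra.
have lim0 : 2 * mean (fun w => X n w ^+ 2) + 2 * mean (fun w => (X n w - G w) ^+ 2)
    @[n --> \oo] --> 2 * (0 : R) + 2 * 0.
  by apply: cvgD; apply: cvgMr; [exact: X0|exact: dist_cvg0].
have G0 : mean (fun w => G w ^+ 2) = 0.
  apply/eqP; rewrite eq_le mean_sqr_ge0 andbT.
  have -> : 0 = 2 * (0 : R) + 2 * 0 by ring.
  rewrite -(cvg_lim _ lim0)//; apply: limr_ge.
    by apply/cvg_ex; eexists; exact: lim0.
  by apply: nearW => n; exact: bound.
have [_ iG] := sG.
have : (\int[P]_w `|(G w ^+ 2)%:E| = 0)%E.
  under eq_integral do rewrite gee0_abs ?lee_fin ?sqr_ge0//.
  by rewrite (integral_sqrE sG) G0.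
move/(ae_eq_integral_abs P measurableT (measurable_int P iG)).
by apply: filterS => w /(_ I) [] /eqP; rewrite sqrf_eq0 => /eqP.
Qed.

End MeanSquareLimit.

Section NormalMoments.
Context {R : realType}.
Local Notation mu := (@lebesgue_measure R).

(** The density is a Radon-Nikodym derivative, almost everywhere equal to the
chosen one. *)
Lemma ge0_integral_normal_prob (s : R) (f : R -> R) : s != 0 ->
  measurable_fun setT f -> (forall x, 0 <= f x) ->
  (\int[normal_prob 0 s]_x (f x)%:E = \int[mu]_x (f x * normal_pdf 0 s x)%:E)%E.
Proof.
move=> s0 mf f0.
have dom := @normal_prob_dominates R 0 s.
have mfE : measurable_fun setT (EFin \o f) by exact/measurable_EFinP.
rewrite -(@Radon_Nikodym_SigmaFinite.change_of_variables _ _ _ (normal_prob 0 s) mu dom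
  (EFin \o f))//.
have mpdf := @measurable_normal_pdf R 0 s.
have ird := Radon_Nikodym_SigmaFinite.f_integrable dom.
apply: ae_eq_integral => //.
- apply: emeasurable_funM => //; exact: measurable_int ird.
- by apply/measurable_EFinP; exact: measurable_funM.
have : ae_eq mu setT (Radon_Nikodym_SigmaFinite.f (normal_prob 0 s) mu)
    (EFin \o normal_pdf 0 s).
  apply: integral_ae_eq => //; first exact/measurable_EFinP.
  by move=> E _ mE; rewrite -Radon_Nikodym_SigmaFinite.f_integral.
by apply: filterS => x /(_ I) /= h _; rewrite /= h EFinM.
Qed.

Let second_moment (s : R) := (\int[normal_prob 0 s]_x (x ^+ 2)%:E)%E.

Let second_moment_pdf (s : R) : s != 0 ->
  second_moment s = (\int[mu]_x (x ^+ 2 * normal_pdf 0 s x)%:E)%E.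
Proof.
move=> s0; apply: (@ge0_integral_normal_prob s (fun x => x ^+ 2)) => //.
by move=> x; exact: sqr_ge0.
Qed.

Let second_moment_lty : (second_moment 1 < +oo)%E.
Proof.
rewrite second_moment_pdf ?oner_eq0//.
(* x^2 <= 4 e^(x^2/4), and e^(-x^2/4) is proportional to the density for s^2 = 2. *)
pose r : R := Num.sqrt 2.
have r0 : r != 0 by rewrite gt_eqF// sqrtr_gt0.
have pr := normal_peak_gt0 r0.
pose K : R := 4 * normal_peak 1 / normal_peak r.
have K0 : 0 <= K by rewrite divr_ge0 ?mulr_ge0 ?normal_peak_ge0.
apply: (@le_lt_trans _ _ (\int[mu]_x (K * normal_pdf 0 r x)%:E)%E).
  apply: le_lower_integral => x _.
    by rewrite lee_fin mulr_ge0 ?sqr_ge0 ?normal_pdf_ge0.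
  rewrite lee_fin !normal_pdfE ?oner_eq0//.
  have -> : K * (normal_peak r * normal_fun 0 r x) =
      normal_peak 1 * (4 * normal_fun 0 r x).
    by rewrite /K; move: (normal_peak r) pr => p p0; field; rewrite gt_eqF.
  rewrite mulrCA ler_wpM2l ?normal_peak_ge0//.
  rewrite /normal_fun !subr0 expr1n sqr_sqrtr//.
  have -> : - x ^+ 2 / (1 *+ 2) = - (x ^+ 2 / 4) + - (x ^+ 2 / 4) by field.
  have -> : - x ^+ 2 / (2 *+ 2) = - (x ^+ 2 / 4) by field.
  rewrite expRD mulrA ler_wpM2r ?expR_ge0// expRN ler_pdivrMr ?expR_gt0//.
  have := expR_ge1Dx (x ^+ 2 / 4); lra.
under eq_integral do rewrite EFinM.
rewrite ge0_integralZl//.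
- by rewrite integral_normal_pdf mule1 ltry.
- by apply/measurable_EFinP; exact: measurable_normal_pdf.
- by move=> x _; rewrite lee_fin normal_pdf_ge0.
Qed.

Let second_moment_scale (s : R) : 0 < s -> second_moment s = ((s ^+ 2)%:E * second_moment 1)%E.
Proof.
move=> s0; have s0' : s != 0 by rewrite gt_eqF.
rewrite !second_moment_pdf ?oner_eq0//.
pose F : R -> R := fun x => s * x.
have FE : F = s *: id by [].
have dF (x : R) : is_derive x 1 F s.
  by rewrite FE; apply: is_derive_eq; rewrite /GRing.scale/= mulr1.
have F'E : F^`()%classic = cst s.
  by apply/funext => x; rewrite derive1E; case: (dF x).
rewrite (@increasing_ge0_integration_by_substitutionT _ F
  (fun x => x ^+ 2 * normal_pdf 0 s x)).
- rewrite F'E -ge0_integralZl//; last 3 first.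
  + apply/measurable_EFinP; apply: measurable_funM => //.
    exact: measurable_normal_pdf.
  + by move=> x _; rewrite lee_fin mulr_ge0 ?sqr_ge0 ?normal_pdf_ge0.
  + by rewrite lee_fin sqr_ge0.
  apply: eq_integral => x _; rewrite -EFinM; congr EFin.
  rewrite /= !fctE /F !normal_pdfE ?oner_eq0//.
  have -> : normal_fun 0 s (s * x) = normal_fun 0 1 x.
    by rewrite /normal_fun !subr0; congr expR; field.
  have -> : normal_peak s = normal_peak 1 / s.
    rewrite /normal_peak expr1n mul1r -mulrnAr sqrtrM ?sqr_ge0//.
    by rewrite sqrtr_sqr gtr0_norm// invfM mulrC.
  by field.
- by move=> x y xy; rewrite ltr_pM2l.
- by rewrite F'E => x; exact: cvg_cst.
- by rewrite F'E; exact: is_cvg_cst.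
- by rewrite F'E; exact: is_cvg_cst.
- by move=> x; case: (dF x).
- exact: gt0_cvgMrNy.
- exact: gt0_cvgMry.
- move=> x; apply: cvgM; first exact: exprn_continuous.
  exact: continuous_normal_pdf.
- by move=> x; rewrite mulr_ge0 ?sqr_ge0 ?normal_pdf_ge0.
Qed.

(** The substitution x = s y in the integral of x^2 against the density extracts
the factor s^2, and c is the second moment for s = 1. *)
Lemma normal_second_moment : exists2 c : R, 0 <= c & forall s : R, 0 < s ->
  (\int[normal_prob 0 s]_x (x ^+ 2)%:E = (s ^+ 2 * c)%:E)%E.
Proof.
have m0 : (0 <= second_moment 1)%E.
  by apply: integral_ge0 => x _; rewrite lee_fin sqr_ge0.
have mfin : second_moment 1 \is a fin_num by rewrite ge0_fin_numE//; exact: second_moment_lty.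
exists (fine (second_moment 1)); first exact: fine_ge0.
by move=> s s0; rewrite EFinM fineK// -second_moment_scale.
Qed.

End NormalMoments.

(** * Increments of the Wiener process *)

Section WienerIncrements.
Context {R : realType} {d : measure_display} {Omega : measurableType d}.
Variables (P : probability Omega R) (W : R -> Omega -> R).
Hypothesis WP : wiener_process P W.
Local Notation "'mean' f" := (\int[P]_w f w) (at level 10, f at level 8).
Local Notation incr s t := (fun w => W t w - W s w).

Let incr_measurable s t : 0 <= s -> s <= t -> measurable_fun setT (incr s t).
Proof.
by move=> s0 st; apply: measurable_funB; apply: (wiener_measurable WP);
  rewrite ?(le_trans s0).
Qed.

Local Notation RR := (measurableTypeR R).

Let incr_law s t : 0 <= s -> s < t -> forall f : RR -> \bar R,
  (\int[pushforward P (incr s t : Omega -> RR)]_x f x =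
   \int[normal_prob 0 (Num.sqrt (t - s))]_x f x)%E.
Proof.
move=> s0 st f; have mi := incr_measurable s0 (ltW st).
have mi' : measurable_fun setT (incr s t : Omega -> RR) by exact: mi.
pose g : {mfun Omega >-> RR} :=
  HB.pack (incr s t : Omega -> RR) (isMeasurableFun.Build _ _ _ _ _ mi').
pose m1 : probability _ R := distribution P g.
pose m2 : probability _ R := normal_prob 0 (Num.sqrt (t - s)).
apply: (@eq_measure_integral _ _ _ setT m2 m1 f) => B mB _.
exact: (wiener_normal WP s0 st mB).
Qed.

Lemma wiener_increment_second_moment : exists2 c : R, 0 <= c & forall s t,
  0 <= s -> s <= t ->
  sq_int P (incr s t) /\ mean (fun w => incr s t w ^+ 2) = c * (t - s).
Proof.
have [c c0 cE] := @normal_second_moment R.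
exists c => // s t s0; rewrite le_eqVlt => /predU1P[<-|st].
  rewrite subrr mulr0 (_ : (incr s s) = cst 0).
    split; first exact: sq_int_cst.
    by rewrite (_ : (fun w => _) = cst 0) ?mean_cst//; apply/funext => w; rewrite subrr expr0n.
  by apply/funext => w; rewrite subrr.
have mi := incr_measurable s0 (ltW st).
have sq : (\int[P]_w (incr s t w ^+ 2)%:E = (c * (t - s))%:E)%E.
  transitivity (\int[pushforward P (incr s t : Omega -> RR)]_x (x ^+ 2)%:E)%E.
    rewrite ge0_integral_pushforward//.
    - by apply/measurable_EFinP; exact: measurable_funX.
    - by move=> x _; rewrite lee_fin sqr_ge0.
  by rewrite incr_law// cE ?sqrtr_gt0 ?subr_gt0// sqr_sqrtr ?subr_ge0 ?ltW// mulrC.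
split; last by rewrite /Rintegral sq.
split=> //; apply/integrableP; split.
  by apply/measurable_EFinP; exact: measurable_funX.
under eq_integral do rewrite /= ger0_norm ?sqr_ge0//.
by rewrite sq ltry.
Qed.

(** The mean of an increment over an interval of length u is additive in u, yet at
most the square root of c u, hence zero. *)
Lemma wiener_increment_mean0 s t : 0 <= s -> s <= t -> mean (incr s t) = 0.
Proof.
have [c c0 sqi] := wiener_increment_second_moment.
move=> s0; rewrite le_eqVlt => /predU1P[<-|st].
  by rewrite (_ : incr s s = cst 0) ?mean_cst//; apply/funext => w; rewrite subrr.
set e := mean (incr s t); pose u := t - s.
have u0 : 0 < u by rewrite subr_gt0.
have pt0 k : 0 <= k%:R * u by rewrite mulr_ge0// ltW.
have ptS k : k%:R * u < k.+1%:R * u by rewrite ltr_pM2r// ltr_nat.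
have ptB k : k.+1%:R * u - k%:R * u = u by rewrite -natr1; ring.
have iid k : P.-integrable setT (EFin \o incr (k%:R * u) (k.+1%:R * u)).
  by apply: sq_int_integrable; exact: (sqi _ _ (pt0 k) (ltW (ptS k))).1.
have mean_law a b : 0 <= a -> a < b ->
    mean (incr a b) = fine (\int[normal_prob 0 (Num.sqrt (b - a))]_x x%:E)%E.
  move=> a0 ab; rewrite -(incr_law a0 ab) /Rintegral; congr fine.
  rewrite integral_pushforward//; first exact: incr_measurable a0 (ltW ab).
  exact: sq_int_integrable (sqi _ _ a0 (ltW ab)).1.
have ek k : mean (incr (k%:R * u) (k.+1%:R * u)) = e.
  by rewrite /e (mean_law _ _ (pt0 k) (ptS k)) (mean_law _ _ s0 st) ptB.
have bound n : n.+1%:R * e ^+ 2 <= c * u.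
  have [_ sumE] := mean_sum 0 n.+1 iid.
  have tele : (fun w => \sum_(0 <= k < n.+1) incr (k%:R * u) (k.+1%:R * u) w) =
      incr 0 (n.+1%:R * u).
    apply/funext => w; rewrite (telescope_sumr (fun k => W (k%:R * u) w))//.
    by rewrite mul0r.
  have nu0 : 0 <= n.+1%:R * u := pt0 n.+1.
  have [sn vn] := sqi _ _ (lexx 0) nu0.
  have := sqr_mean_le sn; rewrite vn subr0 -tele sumE.
  rewrite (eq_bigr _ (fun k _ => ek k)) sumr_const_nat subn0 -(mulr_natl e) exprMn.
  by rewrite [leRHS]mulrCA [X in X * _ <= _]expr2 -mulrA ler_pM2l.
have e2 : e ^+ 2 <= 0.
  rewrite leNgt; apply/negP => e_gt0.
  have := archi_boundP (divr_ge0 (mulr_ge0 c0 (ltW u0)) (ltW e_gt0)).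
  rewrite ltr_pdivrMr// => h.
  have := bound (Num.bound (c * u / e ^+ 2)).
  rewrite leNgt => /negP; apply; rewrite (lt_trans h)// ltr_pM2r// ltr_nat.
  exact: ltnSn.
by apply/eqP; rewrite -sqrf_eq0 eq_le e2 sqr_ge0.
Qed.

(** By polarization the product of two increments is a combination of squares of
increments, whose means are proportional to the lengths of the intervals. *)
Lemma wiener_increment_orthogonal a b s t : 0 <= a -> a <= b -> b <= s -> s <= t ->
  mean (fun w => incr a b w * incr s t w) = 0.
Proof.
have [c c0 sqi] := wiener_increment_second_moment.
move=> a0 ab bs st.
have b0 := le_trans a0 ab; have as_ := le_trans ab bs; have bt := le_trans bs st.
have at_ := le_trans as_ st.
have [[_ i1] v1] := sqi _ _ a0 at_; have [[_ i2] v2] := sqi _ _ a0 as_.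
have [[_ i3] v3] := sqi _ _ b0 bt; have [[_ i4] v4] := sqi _ _ b0 bs.
have iZ (f : Omega -> R) k : P.-integrable setT (EFin \o f) ->
    P.-integrable setT (EFin \o (fun w => k * f w)).
  by move=> fi; exact: (integrableZl measurableT k fi).
have iD (f g : Omega -> R) : P.-integrable setT (EFin \o f) ->
    P.-integrable setT (EFin \o g) -> P.-integrable setT (EFin \o (fun w => f w + g w)).
  by move=> fi gi; exact: (integrableD measurableT fi gi).
transitivity (mean (fun w => (2^-1 * incr a t w ^+ 2 + - 2^-1 * incr a s w ^+ 2) +
    (- 2^-1 * incr b t w ^+ 2 + 2^-1 * incr b s w ^+ 2))).
  by apply: eq_Rintegral => w _; field.
rewrite meanD; [|by apply: iD; apply: iZ..].
rewrite meanD; [|by apply: iZ..].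
rewrite [X in _ + X]meanD; [|by apply: iZ..].
by rewrite !meanZ// v1 v2 v3 v4; ring.
Qed.

End WienerIncrements.

Section StepFunctions.
Context {R : realType} {d : measure_display} {Omega : measurableType d}.
Variables (P : probability Omega R) (W : R -> Omega -> R).
Hypothesis WP : wiener_process P W.
Local Notation "'mean' f" := (\int[P]_w f w) (at level 10, f at level 8).
Variables (t : R) (n : nat) (p : nat -> R) (v : nat -> R).
Hypothesis p0 : p 0%N = 0.
Hypothesis pn : p n = t.
Hypothesis p_incr : forall i, (i < n)%N -> p i <= p i.+1.

Let X w := \sum_(i < n) (W (p i.+1) w - W (p i) w) * v i.

Let p_mono i j : (i <= j)%N -> (j <= n)%N -> p i <= p j.
Proof.
move=> ij; elim: j ij => [|j IH]; first by rewrite leqn0 => /eqP ->.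
rewrite leq_eqVlt => /predU1P[->//|ij] jn.
by rewrite (le_trans (IH _ (ltnW jn)))// p_incr.
Qed.

Let p_ge0 i : (i <= n)%N -> 0 <= p i.
Proof. by move=> ii; rewrite -p0 p_mono. Qed.

Let Y i w := if (i < n)%N then v i * (W (p i.+1) w - W (p i) w) else 0.

Let XE : X = fun w => \sum_(0 <= i < n) Y i w.
Proof.
apply/funext => w; rewrite big_mkord; apply: eq_bigr => i _.
by rewrite /Y ltn_ord mulrC.
Qed.

Let Y_out i : (n <= i)%N -> Y i = cst 0.
Proof. by move=> ni; apply/funext => w; rewrite /Y ltnNge ni. Qed.

Let Y_in i : (i < n)%N -> Y i = fun w => v i * (W (p i.+1) w - W (p i) w).
Proof. by move=> ni; apply/funext => w; rewrite /Y ni. Qed.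

Let sY i : sq_int P (Y i).
Proof.
have [c c0 sqi] := wiener_increment_second_moment WP.
have [ni|ni] := leqP n i; first by rewrite Y_out//; exact: sq_int_cst.
rewrite Y_in//; apply: sq_intZ.
by apply: (sqi _ _ _ _).1; [exact: p_ge0 (ltnW ni)|exact: p_incr].
Qed.

Lemma step_integral_sq_int : sq_int P X.
Proof. by rewrite XE; exact: sq_int_sum. Qed.

Lemma step_integral_mean0 : mean X = 0.
Proof.
have [c c0 sqi] := wiener_increment_second_moment WP.
rewrite XE; have [_ ->] := mean_sum 0 n (fun i => sq_int_integrable (sY i)).
rewrite big_nat big1// => i /andP[_ ni]; rewrite Y_in// meanZ; last first.
  by apply: sq_int_integrable; apply: (sqi _ _ _ _).1;
    [exact: p_ge0 (ltnW ni)|exact: p_incr].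
by rewrite (wiener_increment_mean0 WP (p_ge0 (ltnW ni)) (p_incr ni)) mulr0.
Qed.

Let Y_orthogonal i j : (i < j)%N -> mean (fun w => Y i w * Y j w) = 0.
Proof.
move=> ij; have [nj|jn] := leqP n j.
  rewrite (_ : (fun w => _) = cst 0) ?mean_cst//.
  by apply/funext => w; rewrite (Y_out nj) mulr0.
have in_ := ltn_trans ij jn.
have [c c0 sqi] := wiener_increment_second_moment WP.
have si := (sqi _ _ (p_ge0 (ltnW in_)) (p_incr in_)).1.
have sj := (sqi _ _ (p_ge0 (ltnW jn)) (p_incr jn)).1.
transitivity (mean (fun w => v i * v j *
    ((W (p i.+1) w - W (p i) w) * (W (p j.+1) w - W (p j) w)))).
  by apply: eq_Rintegral => w _; rewrite Y_in// Y_in//; ring.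
rewrite meanZ; last exact: sq_int_prod si sj.
rewrite (wiener_increment_orthogonal WP) ?mulr0//.
- exact: p_ge0 (ltnW in_).
- exact: p_incr.
- exact: p_mono (ltnW jn).
- exact: p_incr.
Qed.

Let h x := \sum_(i < n) \1_(`[p i, p i.+1[%classic) x * v i.

Let h_sqr x : h x ^+ 2 = \sum_(i < n) \1_(`[p i, p i.+1[%classic) x * v i ^+ 2.
Proof.
rewrite /h expr2 big_distrl/=; apply: eq_bigr => i _.
rewrite (bigD1 i)//= mulrDr big_distrr/= [X in _ + X]big1 => [|j ji].
  by rewrite indicE; case: (_ \in _) => /=; rewrite ?mul1r ?mul0r ?addr0// expr2.
rewrite !indicE; case: (boolP (x \in _)) => [xi|_]; last by rewrite !mul0r.
case: (boolP (x \in _)) => [xj|_]; last by rewrite mul0r mulr0.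
move: xj xi; rewrite !inE /= !in_itv/= => /andP[xj xj'] /andP[xi xi']; exfalso.
move: ji; rewrite -(inj_eq val_inj) neq_ltn => /orP[ij|ij].
- have := p_mono ij (ltnW (ltn_ord i)); move: xj' xi; move: (p _) (p _) => a b; lra.
- have := p_mono ij (ltnW (ltn_ord j)); move: xj xi'; move: (p _) (p _) => a b; lra.
Qed.

(** Both sides are sums of squares: on the left because the increments are
orthogonal, on the right because the intervals are disjoint. *)
Lemma ito_isometry_step (c : R) :
  (forall s u, 0 <= s -> s <= u ->
     sq_int P (fun w => W u w - W s w) /\
     mean (fun w => (W u w - W s w) ^+ 2) = c * (u - s)) -> 0 <= c ->
  (\int[P]_w (X w ^+ 2)%:E =
   c%:E * \int[lebesgue_measure]_(x in `[0%R, t]) (h x ^+ 2)%:E)%E.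
Proof.
move=> sqi c0; rewrite (integral_sqrE step_integral_sq_int) XE orthogonal_sum//.
have -> : (\int[lebesgue_measure]_(x in `[0%R, t]) (h x ^+ 2)%:E =
    \sum_(i < n) (v i ^+ 2 * (p i.+1 - p i))%:E)%E.
  under eq_integral do rewrite h_sqr -sumEFin.
  rewrite ge0_integral_sum//; last 2 first.
  - by move=> i; apply/measurable_EFinP; apply: measurable_funM.
  - by move=> i x _; rewrite lee_fin mulr_ge0 ?sqr_ge0// indicE.
  apply: eq_bigr => i _.
  under eq_integral do rewrite mulrC EFinM.
  rewrite ge0_integralZl//; last 2 first.
  - by apply/measurable_EFinP.
  - by rewrite lee_fin sqr_ge0.
  rewrite integral_indic//= setIidl; last first.
    apply/subset_itvP; apply: subset_itv; rewrite bnd_simp.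
      exact: p_ge0 (ltnW (ltn_ord i)).
    by rewrite -pn p_mono.
  rewrite lebesgue_measure_itv/= lte_fin EFinM.
  have := p_incr (ltn_ord i); rewrite le_eqVlt => /predU1P[->|->//].
  by rewrite ltxx subrr.
rewrite sumEFin -EFinM; congr EFin; rewrite big_mkord mulr_sumr.
apply: eq_bigr => i _; rewrite (_ : (fun w => _) = (fun w => v i ^+ 2 *
   (W (p i.+1) w - W (p i) w) ^+ 2)); last first.
  by apply/funext => w; rewrite Y_in// exprMn.
have [[_ ii] vi] := sqi _ _ (p_ge0 (ltnW (ltn_ord i))) (p_incr (ltn_ord i)).
by rewrite meanZ// vi; ring.
Qed.

End StepFunctions.

(** * Stochastic integrals of multiples of the constant function *)

Section Evaluation.
Context {R : realType} (l : R).
Hypothesis l_gt0 : 0 < l.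
Local Notation one := (indic_itvl l).
Implicit Types (f g : bcfun l) (x y : R).

Lemma itvl0 : itvl l (0 : R).
Proof. by rewrite /itvl/= in_itv/= oppr_le0 ltW. Qed.

Lemma bcfun_sumE n (F : nat -> bcfun l) x : (\sum_(i < n) F i) x = \sum_(i < n) F i x.
Proof. by elim/big_ind2 : _ => // u f v g <- <-. Qed.

Lemma bcfun_sub_eval f g x : (f - g) x = f x - g x.
Proof. by []. Qed.

Lemma abs_eval_le_norm f x : itvl l x -> `|f x| <= `|f|.
Proof. exact: supnorm_ub. Qed.

Lemma norm_scale_one (c : R) : `|c *: one| <= `|c|.
Proof.
apply: supnorm_le => // x lx.
by rewrite bcfunZE oneE// mulr1.
Qed.

Lemma eval_continuous x : itvl l x -> continuous (fun f : bcfun l => f x).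
Proof.
move=> lx f A /nbhs_ballP[e /= e0 eA]; apply/nbhs_ballP; exists e => //= g.
rewrite -ball_normE /= => fg; apply: eA; rewrite -ball_normE /=.
by apply: le_lt_trans fg; rewrite -bcfun_sub_eval; exact: abs_eval_le_norm.
Qed.

(** The factor 1/2 lets a single norm bound the difference of two evaluations, so
that one comparison of integrals suffices where the norm is not measurable. *)
Lemma half_difference_sqr_le f x y : itvl l x -> itvl l y ->
  (2^-1 * (f x - f y)) ^+ 2 <= `|f| ^+ 2.
Proof.
move=> lx ly; rewrite -(@ger0_norm _ ((_ * _) ^+ 2)) ?sqr_ge0// normrX.
rewrite lerXn2r ?nnegrE// normrM gtr0_norm ?invr_gt0//.
rewrite mulrC ler_pdivrMr// mulr_natr mulr2n (le_trans (ler_normB _ _))//.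
by rewrite lerD// abs_eval_le_norm.
Qed.

Lemma sqr_eval_le f x : itvl l x -> f x ^+ 2 <= `|f| ^+ 2.
Proof.
move=> lx; rewrite -(@ger0_norm _ (_ ^+ 2)) ?sqr_ge0// normrX.
by rewrite lerXn2r ?nnegrE// abs_eval_le_norm.
Qed.

(** Reduces the identity of two functions to countably many evaluations. *)
Lemma bcfun_constant_rat f :
  (forall q : rat, itvl l (ratr q) -> f (ratr q) = f 0) -> f = f 0 *: one.
Proof.
move=> fq; apply: bcfun_ext => x lx; rewrite bcfunZE oneE// mulr1.
apply/eqP; rewrite -subr_eq0 -normr_le0 leNgt; apply/negP => e0.
have /set_mem[cf _ _] := bcfun_prop f.
have /subspace_continuousP/(_ x lx)/cvgrPdist_lt/(_ _ e0) := cf.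
rewrite near_withinE => -[r /= r0 near_x].
have lxr : x < Num.min (x + r) l.
  by move: lx; rewrite /itvl/= in_itv/= lt_min ltrDl r0 => /andP[].
have [q] := rat_in_itvoo lxr; rewrite in_itv/= lt_min => /andP[xq /andP[qr ql]].
have lq : itvl l (ratr q).
  move: lx; rewrite /itvl/= !in_itv/= => /andP[lx _].
  by rewrite ql (le_trans lx (ltW xq)).
have qx : `|x - ratr q| < r by rewrite ltr0_norm ?subr_lt0// opprB ltrBlDl.
have : `|f x - f (ratr q)| < `|f x - f 0| := near_x _ qx lq.
by rewrite fq// ltxx.
Qed.

Lemma eval_measurable x : itvl l x ->
  measurable_fun setT (fun f : borel (bcfun l) => (f : bcfun l) x : measurableTypeR R).
Proof.
move=> lx; apply: (measurability _ (RGenOpens.measurableE R)).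
move=> _ [_ [a [b ->] <-]]; rewrite setTI.
apply: sub_sigma_algebra; have : open `]a, b[%classic by exact: interval_open.
by apply: open_comp => f _; exact: eval_continuous.
Qed.

Lemma borel_measurable d (T : measurableType d) (J : T -> bcfun l) :
  (forall U : set (bcfun l), open U -> measurable (J @^-1` U)) ->
  measurable_fun setT (J : T -> borel (bcfun l)).
Proof.
move=> mJ; apply: (@measurability _ _ _ (borel (bcfun l)) setT J (@open (bcfun l)) erefl).
by move=> _ [U oU <-]; rewrite setTI; exact: mJ.
Qed.

End Evaluation.

Section ConstantIntegrand.
Context {R : realType} (l : R) {d : measure_display} {Omega : measurableType d}.
Hypothesis l_gt0 : 0 < l.
Local Notation one := (indic_itvl l).
Variables (P : probability Omega R) (W : R -> Omega -> R).
Hypothesis WP : wiener_process P W.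
Variables (t : R) (k : R -> R) (J : Omega -> bcfun l).
Hypothesis kJ : wiener_integral P W t (fun tau => k tau *: one) J.
Local Notation "'mean' f" := (\int[P]_w f w) (at level 10, f at level 8).

Let eval_J_measurable x : itvl l x -> measurable_fun setT (fun w => J w x).
Proof.
move=> lx; have [mJ _] := kJ.
have mev := eval_measurable lx; have mJ' := borel_measurable mJ.
exact: (measurableT_comp mev mJ').
Qed.

Let step_eval (h : stepfun (bcfun l)) x w : step_integral W h w x =
  \sum_(i < sf_size h) (W (sf_pt h i.+1) w - W (sf_pt h i) w) * sf_val h i x.
Proof.
rewrite /step_integral
  (bcfun_sumE _ (fun i => (W (sf_pt h i.+1) w - W (sf_pt h i) w) *: sf_val h i)).
by [].
Qed.

Let stepfun_eval_eval (h : stepfun (bcfun l)) x y : stepfun_eval h y x =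
  \sum_(i < sf_size h) \1_(`[sf_pt h i, sf_pt h i.+1[%classic) y * sf_val h i x.
Proof.
rewrite /stepfun_eval
  (bcfun_sumE _ (fun i => \1_(`[sf_pt h i, sf_pt h i.+1[%classic) y *: sf_val h i)).
by [].
Qed.

(** Evaluation at 0 is a mean square limit of integrals of step functions, which
are centred. *)
Lemma constant_integrand_moments :
  sq_int P (fun w => J w 0) /\ mean (fun w => J w 0) = 0.
Proof.
have [mJ [h [hp _ hJ]]] := kJ; have l0 := itvl0 l_gt0.
pose X n w := step_integral W (h n) w 0.
have XE n : X n = fun w => \sum_(i < sf_size (h n))
    (W (sf_pt (h n) i.+1) w - W (sf_pt (h n) i) w) * sf_val (h n) i 0.
  by apply/funext => w; rewrite /X step_eval.
have sX n : sq_int P (X n).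
  have [p0 pn p_incr] := hp n; rewrite XE.
  exact: (step_integral_sq_int WP (fun i => sf_val (h n) i 0) p0 p_incr).
have X0 n : mean (X n) = 0.
  have [p0 pn p_incr] := hp n; rewrite XE.
  exact: (step_integral_mean0 WP (fun i => sf_val (h n) i 0) p0 p_incr).
have mG := eval_J_measurable l0.
have XG : (\int[P]_w ((X n w - J w 0) ^+ 2)%:E)%E @[n --> \oo] --> 0%E.
  apply: (squeeze_cvge _ (cvg_cst 0%E) hJ); apply: nearW => n; apply/andP; split.
    by apply: integral_ge0 => w _; rewrite lee_fin sqr_ge0.
  apply: le_lower_integral => w _; rewrite lee_fin ?sqr_ge0//.
  by rewrite /X -bcfun_sub_eval sqr_eval_le.
split; first exact: mean_square_limit_sq_int sX mG XG.
exact: mean_square_limit_mean0 sX mG XG X0.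
Qed.

(** The difference of two evaluations of the integral is the mean square limit of
integrals of the differences of the step functions at x and y. By the isometry
these tend to 0, as the integrand takes equal values at x and y. *)
Let eval_eq_ae x y : itvl l x -> itvl l y -> {ae P, forall w, J w x = J w y}.
Proof.
move=> lx ly; have [mJ [h [hp hg hJ]]] := kJ.
have [c c0 sqi] := wiener_increment_second_moment WP.
pose v n i := 2^-1 * (sf_val (h n) i x - sf_val (h n) i y).
pose X n w := \sum_(i < sf_size (h n))
  (W (sf_pt (h n) i.+1) w - W (sf_pt (h n) i) w) * v n i.
pose G w := 2^-1 * (J w x - J w y).
have XE n w : X n w = 2^-1 * (step_integral W (h n) w x - step_integral W (h n) w y).
  rewrite !step_eval -sumrB mulr_sumr; apply: eq_bigr => i _.
  by rewrite /v; ring.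
have sX n : sq_int P (X n).
  by have [p0 pn p_incr] := hp n; exact: (step_integral_sq_int WP _ p0 p_incr).
have mG : measurable_fun setT G.
  by apply: measurable_funM => //; apply: measurable_funB; exact: eval_J_measurable.
have XG : (\int[P]_w ((X n w - G w) ^+ 2)%:E)%E @[n --> \oo] --> 0%E.
  apply: (squeeze_cvge _ (cvg_cst 0%E) hJ); apply: nearW => n; apply/andP; split.
    by apply: integral_ge0 => w _; rewrite lee_fin sqr_ge0.
  apply: le_lower_integral => w _; rewrite lee_fin ?sqr_ge0// XE /G.
  apply: le_trans (half_difference_sqr_le (step_integral W (h n) w - J w) lx ly).
  rewrite !bcfun_sub_eval le_eqVlt; apply/orP; left; apply/eqP; ring.
have X0 : mean (fun w => X n w ^+ 2) @[n --> \oo] --> (0 : R).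
  suff : (\int[P]_w (X n w ^+ 2)%:E)%E @[n --> \oo] --> 0%E by move/fine_cvg.
  have chg := cvgeZl (erefl : c%:E \is a fin_num) hg; rewrite mule0 in chg.
  apply: (squeeze_cvge _ (cvg_cst 0%E) chg); apply: nearW => n; apply/andP; split.
    by apply: integral_ge0 => w _; rewrite lee_fin sqr_ge0.
  have [p0 pn p_incr] := hp n.
  rewrite (ito_isometry_step WP (v n) p0 pn p_incr sqi c0) lee_wpmul2l ?lee_fin//.
  apply: le_lower_integral => z _; rewrite lee_fin ?sqr_ge0//.
  apply: le_trans (half_difference_sqr_le (stepfun_eval (h n) z - k z *: one) lx ly).
  rewrite le_eqVlt; apply/orP; left; apply/eqP; congr (_ ^+ 2).
  transitivity (2^-1 * (stepfun_eval (h n) z x - stepfun_eval (h n) z y)); last first.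
    by rewrite !bcfun_sub_eval !bcfunZE !oneE//; ring.
  rewrite !stepfun_eval_eval -sumrB mulr_sumr; apply: eq_bigr => i _.
  by rewrite /v; ring.
have := mean_square_limit_ae0 sX mG XG X0.
apply: filterS => w /eqP; rewrite mulf_eq0 invr_eq0 pnatr_eq0/= subr_eq0.
by move/eqP.
Qed.

Lemma constant_integrand_ae : {ae P, forall w, J w = J w 0 *: one}.
Proof.
have l0 := itvl0 l_gt0.
have : {ae P, forall w, forall n : nat, forall q : rat, unpickle n = Some q ->
    itvl l (ratr q) -> J w (ratr q) = J w 0}.
  apply/ae_foralln => n.
  case E : (@unpickle rat n) => [q|]; last by apply: aeW.
  have [lq|lq] := pselect (itvl l (ratr q)).
    by apply: filterS (eval_eq_ae lq l0) => w Jw _ [<-].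
  by apply: aeW => w _ [<-].
apply: filterS => w Jw; apply: bcfun_constant_rat => q lq.
by apply: (Jw (pickle q)) => //; exact: pickleK.
Qed.

End ConstantIntegrand.

(** * Consistency of the estimator *)

Section Laws.
Context d (T : measurableType d) (R : realType) (P : probability T R).

Lemma probability_ae (A : set T) : measurable A -> P A = 1%E -> {ae P, forall w, A w}.
Proof.
move=> mA PA; exists (~` A); split=> //; first exact: measurableC.
by rewrite probability_setC// PA subee.
Qed.

Lemma ae_probability (A : set T) : measurable A -> {ae P, forall w, A w} -> P A = 1%E.
Proof.
move=> mA [B [mB B0 AB]].
have : P (~` A) = 0%E by apply: subset_measure0 B0 => //; exact: measurableC.
move=> PC; rewrite -[A]setCK probability_setC; last exact: measurableC.
by rewrite PC sube0.
Qed.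

Lemma ae_completed_measure_eq1 (A : set T) :
  {ae P, forall w, A w} -> completed_measure_eq1 P A.
Proof.
move=> [B [mB B0 AB]]; exists (~` B); split; first exact: measurableC.
- by apply: subsetCl.
- by rewrite probability_setC// B0 sube0.
Qed.

(** Moments only depend on the law. *)
Lemma equal_laws d' (T' : measurableType d') (P' : probability T' R)
    (X : T -> R) (Y : T' -> R) :
  measurable_fun setT Y ->
  (forall B, measurable B -> P' (Y @^-1` B) = P (X @^-1` B)) -> sq_int P X ->
  [/\ sq_int P' Y, \int[P']_w Y w = \int[P]_w X w &
      \int[P']_w (Y w ^+ 2) = \int[P]_w (X w ^+ 2)].
Proof.
move=> mY law sX; have [mX iX2] := sX; have iX := sq_int_integrable sX.
pose fX : {mfun T >-> R} := HB.pack X (isMeasurableFun.Build _ _ _ _ _ mX).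
pose fY : {mfun T' >-> R} := HB.pack Y (isMeasurableFun.Build _ _ _ _ _ mY).
pose m1 : probability _ R := distribution P fX.
pose m2 : probability _ R := distribution P' fY.
have lawE (f : R -> \bar R) : (\int[m2]_x f x = \int[m1]_x f x)%E.
  by apply: (@eq_measure_integral _ _ _ setT m1 m2 f) => B mB _; exact: law.
have transfer (f : R -> R) : measurable_fun setT f -> (forall x, 0 <= f x) ->
    (\int[P']_w (f (Y w))%:E = \int[P]_w (f (X w))%:E)%E.
  move=> mf f0; have mfE : measurable_fun setT (EFin \o f) by exact/measurable_EFinP.
  have f0E : {in [set: R], forall x, (0 <= (EFin \o f) x)%E} by move=> x _; rewrite lee_fin.
  rewrite -(ge0_integral_pushforward mY P' measurableT mfE f0E).
  by rewrite [LHS]lawE (ge0_integral_pushforward mX P measurableT mfE f0E).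
have iY2 : P'.-integrable setT (EFin \o (fun w => Y w ^+ 2)).
  apply/integrableP; split.
    by apply/measurable_EFinP; exact: measurable_funX.
  under eq_integral do rewrite /= ger0_norm ?sqr_ge0//.
  rewrite (transfer (fun x => x ^+ 2))//; last by move=> x; exact: sqr_ge0.
  by rewrite (integral_sqrE sX) ltry.
have sY : sq_int P' Y by [].
split=> //.
- rewrite /Rintegral; congr fine.
  have mid : measurable_fun [set: R] (EFin : R -> \bar R) by exact/measurable_EFinP.
  rewrite -(@integral_pushforward _ _ _ _ _ _ mY P' setT EFin mid
    (sq_int_integrable sY) measurableT).
  by rewrite [LHS]lawE (@integral_pushforward _ _ _ _ _ _ mX P setT EFin mid iX measurableT).
- rewrite /Rintegral; congr fine; apply: (transfer (fun x => x ^+ 2)) => // x.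
  exact: sqr_ge0.
Qed.

End Laws.

Section CountableProduct.
Context d (T : measurableType d) (R : realType).
Variables (mu : set T -> \bar R) (M : probability (seq_space T) R).
Hypothesis MP : countable_product mu M.
Hypothesis muT : mu setT = 1%E.

Lemma coordinate_measurable k : measurable_fun setT (fun Z : seq_space T => (Z : nat -> T) k).
Proof.
move=> _ B mB; rewrite setTI; apply: sub_sigma_algebra.
by exists k, B.
Qed.

Lemma countable_product_pair i j (B C : set T) : (i < j)%N ->
  measurable B -> measurable C ->
  M [set Z : nat -> T | B (Z i) /\ C (Z j)] = (mu B * mu C)%E.
Proof.
move=> ij mB mC.
pose F k := if k == i then B else if k == j then C else setT.
have mF k : measurable (F k) by rewrite /F; do 2 case: ifP => // _.
rewrite (_ : [set Z | _] = [set Z : nat -> T | forall k, (k < j.+1)%N -> F k (Z k)]).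
  rewrite MP// (bigD1 (Ordinal (ltnW ij : (i < j.+1)%N)))//= {1}/F eqxx; congr (_ * _)%E.
  have ne : (Ordinal (ltnSn j) != Ordinal (ltnW ij : (i < j.+1)%N)).
    by rewrite -(inj_eq val_inj)/= gtn_eqF.
  rewrite (bigD1 (Ordinal (ltnSn j)))//= {1}/F gtn_eqF// eqxx big1 ?mule1//.
  move=> k /andP[ki kj]; rewrite /F.
  by rewrite -!(inj_eq val_inj)/= in ki kj; rewrite (negbTE ki) (negbTE kj).
apply/seteqP; split=> Z /=.
  move=> [Bi Cj] k _; rewrite /F; case: eqP => [->//|_]; case: eqP => [->//|//].
move=> FZ; have := FZ i (ltnW ij : (i < j.+1)%N); have := FZ j (ltnSn j).
by rewrite /F eqxx (gtn_eqF ij) eqxx.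
Qed.

Lemma countable_product_coordinate i (B : set T) : measurable B ->
  M [set Z : nat -> T | B (Z i)] = mu B.
Proof.
move=> mB; rewrite -[RHS]mule1 -muT -(@countable_product_pair i i.+1)//.
by congr (M _); apply/seteqP; split=> Z //= [].
Qed.

End CountableProduct.

Theorem theorem3p1 (R : realType) (l : R) (l_gt0 : 0 < l)
    (m : nat) (m_ge1 : (1 <= m)%N)
    (A : nat -> R) (A0_gt0 : 0 < A 0%N) (sigma : R) (sigma_gt0 : 0 < sigma)
    (d : measure_display) (Omega : measurableType d) (P : probability Omega R)
    (W : R -> Omega -> R) (W_wiener : wiener_process P W)
    (N : R -> Omega -> R)
    (N_integral : forall t : R, 0 <= t ->
       wiener_integral P W t (fun tau => expR ((t - tau) * A 0%N)) (N t))
    (J : R -> Omega -> bcfun l)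
    (J_integral : forall t : R, 0 <= t ->
       wiener_integral P W t (fun tau => expA m A (t - tau) (indic_itvl l)) (J t))
    (theta : bcfun l) (theta_FD0 : FD0 theta)
    (theta_regular : regular m A sigma theta N)
    (t0 : R) (t0_gt0 : 0 < t0)
    (xi : R -> Omega -> bcfun l)
    (xi_def : forall (t : R) (w : Omega), 0 <= t ->
       xi t w = expA m A t theta + sigma *: J t w)
    (mu_theta : set (borel (bcfun l)) -> \bar R)
    (mu_theta_def : mu_theta = pushforward P (xi t0 : Omega -> borel (bcfun l)))
    (M : probability (seq_space (borel (bcfun l))) R)
    (M_product : countable_product mu_theta M) :
  completed_measure_eq1 M
    [set Z : nat -> bcfun l |
      (forall n, (0 < n)%N -> estimator_defined m A t0 n Z) /\
      `|estimator m A t0 n Z - theta| @[n --> \oo] --> 0].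
Proof.
set one := indic_itvl l.
have t0_ge0 := ltW t0_gt0.
have l0 := itvl0 l_gt0.
have [g [g_FD0 _] g_lim] := theta_regular.1 t0 point t0_ge0.
(* A single sample point identifies e^(t0 A) theta. *)
pose h := g + (- (sigma * N t0 point)) *: one.
have h_expA : is_expA m A t0 theta h.
  split=> // x lx.
  have lim : series (fun k => expA_term l m A t0 theta k x) n + sigma * N t0 point * one x
      - sigma * N t0 point * one x @[n --> \oo] --> g x - sigma * N t0 point * one x.
    by apply: cvgB; [exact: g_lim|exact: cvg_cst].
  rewrite bcfunDE bcfunZE mulNr; apply: cvg_trans lim.
  by apply: near_eq_cvg; apply: nearW => n /=; rewrite addrK.
have h_FD0 : FD0 h by exact: FD0_affine.
have inverse c : is_expA m A (- t0) (h + c *: one)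
    (theta + (expR (- t0 * A 0%N) * c) *: one).
  exact: is_expA_inverse_affine.
have J_int : wiener_integral P W t0
    (fun tau => expR ((t0 - tau) * A 0%N) *: one) (J t0).
  have := J_integral t0 t0_ge0; congr (wiener_integral _ _ _ _ _).
  by apply/funext => tau; apply: is_expA_expA; exact: is_expA_one.
have [sG EG] := constant_integrand_moments l_gt0 W_wiener J_int.
have J_const := constant_integrand_ae l_gt0 W_wiener J_int.
have xiE w : xi t0 w = h + sigma *: J t0 w.
  by rewrite xi_def// (is_expA_expA h_expA).
(* The coordinate c on the line of functions h + c 1, and this line. *)
pose y (f : bcfun l) := f 0 - h 0.
have my : measurable_fun setT (y : borel (bcfun l) -> R).
  by apply: measurable_funB => //; exact: eval_measurable.
pose C : set (borel (bcfun l)) := [set f : bcfun l | f = h + y f *: one].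
have mC : measurable C.
  have -> : C = \bigcap_n [set f : bcfun l | forall q : rat, unpickle n = Some q ->
      itvl l (ratr q) -> f (ratr q) - h (ratr q) = y f].
    apply/seteqP; split=> f /=.
      move=> fC n _ q _ lq.
      have -> : f (ratr q) = (h + y f *: one) (ratr q) by rewrite -fC.
      by rewrite bcfunDE bcfunZE oneE// mulr1 addrAC subrr add0r.
    move=> fq; rewrite /C /= /y -bcfun_sub_eval -bcfun_constant_rat ?subrKC//.
    by move=> q lq; apply: (fq (pickle q)) => //; exact: pickleK.
  apply: bigcapT_measurable => n.
  case E : (@unpickle rat n) => [q|]; last first.
    by rewrite (_ : [set f | _] = setT)//; apply/seteqP; split=> f // _ q //.
  have [lq|lq] := pselect (itvl l (ratr q)); last first.
    by rewrite (_ : [set f | _] = setT)//; apply/seteqP; split=> f // _ q' [<-].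
  rewrite (_ : [set f | _] = (fun f : borel (bcfun l) =>
      ((f : bcfun l) (ratr q) - h (ratr q)) - y f) @^-1` [set 0]); last first.
    apply/seteqP; split=> f /=.
      by move=> /(_ q erefl lq) ->; rewrite subrr.
    by move=> /eqP; rewrite subr_eq0 => /eqP fq q' [<-].
  rewrite -[X in measurable X]setTI.
  have : measurable_fun setT (fun f : borel (bcfun l) =>
      ((f : bcfun l) (ratr q) - h (ratr q)) - y f).
    by do 2 apply: measurable_funB => //; exact: eval_measurable.
  by apply.
have xi_measurable : measurable_fun setT (xi t0 : Omega -> borel (bcfun l)).
  apply: borel_measurable => U oU.
  have [mJ _] := J_integral t0 t0_ge0.
  rewrite (_ : xi t0 @^-1` U = J t0 @^-1` ((fun f => h + sigma *: f) @^-1` U)).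
    apply: mJ; apply: open_comp oU => f _.
    have cs : (fun f : bcfun l => sigma *: f) @ f --> sigma *: f by exact: scaler_continuous.
    have ch : (fun _ : bcfun l => h) @ f --> h by exact: cst_continuous.
    exact: (cvgD ch cs).
  by apply/seteqP; split=> w /=; rewrite xiE.
have muE B : mu_theta B = P (xi t0 @^-1` B) by rewrite mu_theta_def.
have muT : mu_theta setT = 1%E by rewrite muE preimage_setT probability_setT.
have y_xi w : y (xi t0 w) = sigma * J t0 w 0.
  by rewrite /y xiE bcfunDE bcfunZE; ring.
have muC : mu_theta C = 1%E.
  rewrite muE; apply: ae_probability.
    by rewrite -[X in measurable X]setTI; exact: xi_measurable.
  apply: filterS J_const => w Jw; rewrite /C /= y_xi xiE -scalerA.
  by rewrite {1}Jw.
pose Y k (Z : seq_space (borel (bcfun l))) := y ((Z : nat -> bcfun l) k).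
have mY k : measurable_fun setT (Y k).
  exact: (measurableT_comp my (@coordinate_measurable _ (borel (bcfun l)) k)).
have Y_preimage k B : measurable B -> M (Y k @^-1` B) = mu_theta (y @^-1` B).
  move=> mB; rewrite -(countable_product_coordinate M_product muT k)//.
  by rewrite -[X in measurable X]setTI; exact: my.
have sX : sq_int P (fun w => sigma * J t0 w 0) by exact: sq_intZ.
have laws k := @equal_laws _ _ _ P _ _ M (fun w => sigma * J t0 w 0) (Y k) (mY k).
have {}laws k : [/\ sq_int M (Y k), \int[M]_Z Y k Z = \int[P]_w (sigma * J t0 w 0) &
    \int[M]_Z (Y k Z ^+ 2) = \int[P]_w ((sigma * J t0 w 0) ^+ 2)].
  apply: laws => // B mB; rewrite Y_preimage// muE; congr (P _).
  by apply/seteqP; split=> w /=; rewrite y_xi.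
have EY k : \int[M]_Z Y k Z = 0.
  by have [_ -> _] := laws k; rewrite meanZ ?EG ?mulr0//; exact: sq_int_integrable.
have Y_orthogonal i j : (i < j)%N -> \int[M]_Z (Y i Z * Y j Z) = 0.
  move=> ij; apply: independent_orthogonal (EY i).
  - by have [] := laws i.
  - by have [] := laws j.
  - move=> B D mB mD; rewrite !Y_preimage//.
    rewrite -(countable_product_pair M_product muT ij)//.
    + by rewrite -[X in measurable X]setTI; exact: my.
    + by rewrite -[X in measurable X]setTI; exact: my.
have lln := @orthogonal_law_of_large_numbers _ _ _ M Y
  (\int[P]_w ((sigma * J t0 w 0) ^+ 2)).
have {}lln : {ae M, forall Z, n%:R^-1 * \sum_(k < n) Y k Z @[n --> \oo] --> (0 : R)}.
  apply: lln => // k; first by have [] := laws k.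
  by have [_ _ ->] := laws k.
have all_C : {ae M, forall Z, forall k, C ((Z : nat -> bcfun l) k)}.
  apply/ae_foralln => k; apply: probability_ae.
    rewrite -[X in measurable X]setTI.
    exact: (@coordinate_measurable _ (borel (bcfun l)) k).
  by rewrite (countable_product_coordinate M_product muT k).
apply: ae_completed_measure_eq1; apply: filterS2 lln all_C => Z mean0 Z_C.
pose c n := n%:R^-1 * \sum_(k < n) Y k Z.
have meanE n : (0 < n)%N ->
    n%:R^-1 *: \sum_(k < n) (Z : nat -> bcfun l) k = h + c n *: one.
  move=> n0.
  have n0R : n%:R != 0 :> R by rewrite pnatr_eq0 -lt0n.
  rewrite (eq_bigr (fun k : 'I_n => h + Y k Z *: one)); last by move=> k _; exact: Z_C.
  rewrite big_split/= sumr_const card_ord -scaler_suml scalerDr scalerA.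
  by rewrite -(scaler_nat n h) scalerA mulVf// scale1r.
split=> [n n0|].
  rewrite /estimator_defined meanE//.
  by exists (theta + (expR (- t0 * A 0%N) * c n) *: one); exact: inverse.
have bound_cvg : expR (- t0 * A 0%N) * `|c n| @[n --> \oo] --> (0 : R).
  rewrite -(mulr0 (expR (- t0 * A 0%N))); apply: cvgMr.
  by rewrite -(@normr0 _ R); apply: cvg_norm; exact: mean0.
apply: (squeeze_cvgr _ (cvg_cst (0 : R)) bound_cvg); near=> n.
have n0 : (0 < n)%N by near: n; exists 1%N.
rewrite normr_ge0/= /estimator meanE// (is_expA_expA (inverse (c n))) addrAC subrr add0r.
by rewrite (le_trans (norm_scale_one _ _))// normrM ger0_norm ?expR_ge0.
Unshelve. all: by end_near. Qed.
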